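(* There exists a Jordan curve $C \subset \mathbb{CP}^1$ with finite width, $w(C) < \infty$, which is not a quasicircle.
   Context: Identify $\mathbb{CP}^1$ with the boundary at infinity of hyperbolic three-space $\mathbb{H}^3$; $d$ denotes the hyperbolic distance on $\mathbb{H}^3$. For a Jordan curve $C \subset \mathbb{CP}^1$, $\mathrm{CH}(C) \subset \mathbb{H}^3$ denotes the convex hull of $C$: the smallest closed convex subset of $\mathbb{H}^3$ whose accumulation set at infinity is $C$. Its boundary in $\mathbb{H}^3$ is the union of two properly embedded disks $\partial^+\mathrm{CH}(C)$ and $\partial^-\mathrm{CH}(C)$, each facing one of the two components of $\mathbb{CP}^1 \setminus C$ (if $C$ is a round circle, $\mathrm{CH}(C)$ is a totally geodesic plane and both disks equal this plane). The width of $C$ is $$w(C) = \sup_{x \in \mathrm{CH}(C)} \left(d(x,\partial^-\mathrm{CH}(C)) + d(x,\partial^+\mathrm{CH}(C))\right) \in [0,\infty].$$ A Jordan curve $C \subset \mathbb{CP}^1$ is a quasicircle if it is the image of $\mathbb{RP}^1 \subset \mathbb{CP}^1$ under a quasiconformal homeomorphism of $\mathbb{CP}^1$. *)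

(* Defs.v *)
From HB Require Import structures.
From mathcomp Require Import all_boot all_order all_algebra.
From mathcomp Require Import all_classical all_reals all_analysis.

Set Implicit Arguments.
Unset Strict Implicit.
Unset Printing Implicit Defensive.

Import Order.TTheory GRing.Theory Num.Theory.
Import numFieldNormedType.Exports.

Local Open Scope classical_set_scope.
Local Open Scope ring_scope.

(* Hyperbolic space is taken in the projective (Klein) ball model: H^3 is the
   open unit ball of R^3 and its boundary at infinity is the unit sphere S^2,
   identified with CP^1 by the stereographic projection
   (x_0, x_1, x_2) |-> (x_0 + i x_1) / (1 - x_2).
   The norm of the library on 'rV[R]_3 is the sup norm; it is used only for the
   topology, and Euclidean lengths go through [dot]. *)

Definition dot (R : realType) (u v : 'rV[R]_3) : R := \sum_i u 0 i * v 0 i.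

Definition edist (R : realType) (u v : 'rV[R]_3) : R :=
  Num.sqrt (dot (u - v) (u - v)).

Definition H3 (R : realType) : set 'rV[R]_3 := [set x | dot x x < 1].
Arguments H3 R : clear implicits.

Definition CP1 (R : realType) : set 'rV[R]_3 := [set x | dot x x = 1].
Arguments CP1 R : clear implicits.

(* The points of S^2 whose stereographic projection is real or infinite. *)
Definition RP1 (R : realType) : set 'rV[R]_3 := CP1 R `&` [set x | x 0 1 = 0].
Arguments RP1 R : clear implicits.

Definition arcosh (R : realType) (u : R) : R := ln (u + Num.sqrt (u ^+ 2 - 1)).

(* Meaningful for x, y in H3. *)
Definition hdist (R : realType) (x y : 'rV[R]_3) : R :=
  arcosh ((1 - dot x y) / Num.sqrt ((1 - dot x x) * (1 - dot y y))).

Definition hsegment (R : realType) (x y : 'rV[R]_3) : set 'rV[R]_3 :=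
  H3 R `&` [set z | hdist x z + hdist z y = hdist x y].

Definition hconvex (R : realType) (K : set 'rV[R]_3) : Prop :=
  forall x y, K x -> K y -> hsegment x y `<=` K.

Definition hclosed (R : realType) (K : set 'rV[R]_3) : Prop :=
  closure K `&` H3 R `<=` K.

Definition accumulation_at_infinity (R : realType) (K : set 'rV[R]_3) :
  set 'rV[R]_3 := closure K `&` CP1 R.

Definition jordan_curve (R : realType) (C : set 'rV[R]_3) : Prop :=
  exists gamma : R -> 'rV[R]_3,
    [/\ {within `[0, 1], continuous gamma},
        gamma 0 = gamma 1,
        {in `[0, 1[ &, injective gamma},
        C = gamma @` `[0, 1]
      & C `<=` CP1 R].

Definition CH (R : realType) (C : set 'rV[R]_3) : set 'rV[R]_3 :=
  \bigcap_(K in [set K | [/\ K `<=` H3 R, hclosed K, hconvex K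
                           & accumulation_at_infinity K = C]]) K.

Definition complementary_component (R : realType) (C Omega : set 'rV[R]_3) :
  Prop := exists2 p, (CP1 R `\` C) p & Omega = connected_component (CP1 R `\` C) p.

(* The connected component containing Omega of the complement of
   CH(C) `|` C in the closed ball H^3 `|` CP^1. *)
Definition side (R : realType) (C Omega : set 'rV[R]_3) : set 'rV[R]_3 :=
  \bigcup_(p in Omega)
    connected_component ((H3 R `|` CP1 R) `\` (CH C `|` C)) p.

(* The part of the boundary of CH(C) in H^3 that faces Omega. When C is a round
   circle, this is the whole plane CH(C) for both choices of Omega. *)
Definition boundaryCH (R : realType) (C Omega : set 'rV[R]_3) : set 'rV[R]_3 :=
  CH C `&` closure (side C Omega).

Definition hdist_set (R : realType) (x : 'rV[R]_3) (A : set 'rV[R]_3) :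
  \bar R := ereal_inf [set (hdist x y)%:E | y in A].

(* By the Jordan curve theorem {Omega1, Omega2} is the pair of components of
   CP^1 \ C, and the summand is symmetric in them, so that the supremum is in
   effect over x alone. *)
Definition width (R : realType) (C : set 'rV[R]_3) : \bar R :=
  ereal_sup [set w | exists x Omega1 Omega2,
    [/\ CH C x,
        complementary_component C Omega1,
        complementary_component C Omega2,
        Omega1 <> Omega2
      & w = (hdist_set x (boundaryCH C Omega1) +
             hdist_set x (boundaryCH C Omega2))%E]].

Definition homeomorphism_CP1 (R : realType) (f : 'rV[R]_3 -> 'rV[R]_3) : Prop :=
  {within CP1 R, continuous f} /\
  exists g : 'rV[R]_3 -> 'rV[R]_3,
    {within CP1 R, continuous g} /\
    forall x, CP1 R x -> [/\ CP1 R (f x), CP1 R (g x), g (f x) = x & f (g x) = x].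

(* Linear dilatation: the limsup, as r tends to 0, of
   max_{|y - x| = r} |f y - f x| / min_{|z - x| = r} |f z - f x|. *)
Definition dilatation (R : realType) (f : 'rV[R]_3 -> 'rV[R]_3) (x : 'rV[R]_3) :
  \bar R :=
  ereal_inf [set ereal_sup
      [set q | exists y z, [/\ CP1 R y, CP1 R z, edist x y = edist x z,
                               0 < edist x y < delta
                             & q = (edist (f x) (f y) / edist (f x) (f z))%:E]]
    | delta in [set delta : R | 0 < delta]].

(* The metric definition, for the chordal metric of S^2. It also allows
   orientation-reversing maps; since complex conjugation preserves RP^1, the
   images of RP^1 are the same. *)
Definition quasiconformal (R : realType) (f : 'rV[R]_3 -> 'rV[R]_3) : Prop :=
  homeomorphism_CP1 f /\
  exists H : R, forall x, CP1 R x -> (dilatation f x <= H%:E)%E.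

Definition quasicircle (R : realType) (C : set 'rV[R]_3) : Prop :=
  exists2 f, quasiconformal f & C = f @` RP1 R.

(* Main.v *)
Require Import Defs.
From HB Require Import structures.
From mathcomp Require Import all_boot all_order all_algebra.
From mathcomp Require Import all_classical all_reals all_analysis.
From mathcomp Require Import ring lra.

(* The curve passes through infinity and 0. In coordinates (u, theta), with u
   growing like the square root of the logarithm of the modulus, one of its two
   arms is a half-line theta = const and the other one is a periodic rectilinear
   zigzag which goes forward, comes back and goes forward again, the three
   strands staying in different directions. The modulus of the annulus over
   one period tends to infinity. Hence the second arm, on its way to infinity,
   comes back by an unbounded factor, which is impossible for the image of a
   circle under a map of finite dilatation at the preimage of infinity. On the
   other hand, at every point of the curve and at every scale both complementary
   components contain discs of comparable size, so that half-spaces missing the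
   convex hull come within bounded distance of every point of the hull, on both
   sides. *)

Set Implicit Arguments.
Unset Strict Implicit.
Unset Printing Implicit Defensive.

Import Order.TTheory GRing.Theory Num.Theory.
Import numFieldNormedType.Exports.

Local Open Scope classical_set_scope.
Local Open Scope ring_scope.

(** * Euclidean and hyperbolic segments *)

Section Vectors.
Variable R : realType.
Implicit Types (u v w x y z n : 'rV[R]_3) (a b c t : R).

(** The linear and the quadratic term of the exponent in [radial] have separate tasks. The linear
    one multiplies the modulus by at least 3 over each unit of [u], which leaves room next to the
    strands for discs proportional to the modulus; this keeps the width finite. The quadratic one
    makes the factor lost on the way back, from [u = 3k + 2] to [u = 3k + 1], at least [1 + 6k];
    with a linear exponent it would stay bounded. The dilatation at one point compares the images of
    points equidistant from it. On a circle every small distance to a given point is attained once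
    on either side of that point, so an arm on which the modulus is monotone acts as a ruler for the
    other arm. This is why one arm is straight. The zigzag also continues for negative [u], towards
    0, so that the half-turn [(u, th) |-> (- u, - th)] preserves it and exchanges its sides. Each
    estimate is then made once, with a sign [e] that selects the side. *)

Lemma dotE u v : dot u v = u 0 0 * v 0 0 + u 0 1 * v 0 1 + u 0 2 * v 0 2.
Proof.
rewrite /dot !big_ord_recl big_ord0 addr0 addrA.
congr (_ + _ * _ + _ * _); congr (_ 0 _); exact: val_inj.
Qed.

Lemma dotC u v : dot u v = dot v u.
Proof. by rewrite !dotE; ring. Qed.

Lemma dotDl u v w : dot (u + v) w = dot u w + dot v w.
Proof. by rewrite !dotE !mxE; ring. Qed.

Lemma dotZl a u w : dot (a *: u) w = a * dot u w.
Proof. by rewrite !dotE !mxE; ring. Qed.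

Lemma dotNl u w : dot (- u) w = - dot u w.
Proof. by rewrite !dotE !mxE; ring. Qed.

Lemma dotDr u v w : dot w (u + v) = dot w u + dot w v.
Proof. by rewrite !dotE !mxE; ring. Qed.

Lemma dotZr a u w : dot w (a *: u) = a * dot w u.
Proof. by rewrite !dotE !mxE; ring. Qed.

Lemma dotNr u w : dot w (- u) = - dot w u.
Proof. by rewrite !dotE !mxE; ring. Qed.

Definition dot_linE := (dotDl, dotDr, dotZl, dotZr, dotNl, dotNr).

Lemma dot_ge0 u : 0 <= dot u u.
Proof. by rewrite dotE -!expr2 !addr_ge0 ?sqr_ge0. Qed.

Lemma row3P u v : [/\ u 0 0 = v 0 0, u 0 1 = v 0 1 & u 0 2 = v 0 2] -> u = v.
Proof.
move=> [h0 h1 h2]; apply/rowP => -[[|[|[|//]]] i3].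
- by rewrite (_ : Ordinal i3 = 0) //; exact: val_inj.
- by rewrite (_ : Ordinal i3 = 1) //; exact: val_inj.
- by rewrite (_ : Ordinal i3 = 2) //; exact: val_inj.
Qed.

Lemma dot_eq0 u : dot u u = 0 -> u = 0.
Proof.
rewrite dotE -!expr2 => u0; apply: row3P; rewrite !mxE.
have h0 := sqr_ge0 (u 0 0); have h1 := sqr_ge0 (u 0 1).
have h2 := sqr_ge0 (u 0 2).
by split; apply/eqP; rewrite -sqrf_eq0; apply/eqP; lra.
Qed.

Lemma cauchy_schwarz u v : dot u v ^+ 2 <= dot u u * dot v v.
Proof.
rewrite !dotE -subr_ge0.
set a0 := u 0 0; set a1 := u 0 1; set a2 := u 0 2.
set b0 := v 0 0; set b1 := v 0 1; set b2 := v 0 2.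
rewrite (_ : _ - _ = (a0 * b1 - a1 * b0) ^+ 2 + (a0 * b2 - a2 * b0) ^+ 2
  + (a1 * b2 - a2 * b1) ^+ 2); last by ring.
by rewrite !addr_ge0 ?sqr_ge0.
Qed.

(** The form [1 - dot x y] is the Minkowski product of the lifts (1, x) and (1, y). The term in
    [x - y] sharpens the reverse Cauchy-Schwarz inequality enough to settle its equality case,
    [H3_eq]. *)
Lemma reverse_cauchy_schwarz x y :
  (1 - dot x x) * (1 - dot y y) + (1 - dot x x) * dot (x - y) (x - y)
  <= (1 - dot x y) ^+ 2.
Proof.
rewrite -subr_ge0 (_ : _ - _ = (dot x x - dot x y) ^+ 2) ?sqr_ge0 //.
by rewrite !dot_linE (dotC y x); ring.
Qed.

Lemma dot_lt1 x y : H3 R x -> H3 R y -> 0 < 1 - dot x y.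
Proof.
rewrite /H3 /= => x1 y1; have := dot_ge0 (x - y).
by rewrite !dot_linE (dotC y x); nra.
Qed.

Lemma H3_gt0 x : H3 R x -> 0 < 1 - dot x x.
Proof. by rewrite /H3 /= subr_gt0. Qed.

Lemma cosh_hdist_ge1 x y : H3 R x -> H3 R y ->
  1 <= (1 - dot x y) / Num.sqrt ((1 - dot x x) * (1 - dot y y)).
Proof.
move=> hx hy; have x0 := H3_gt0 hx; have y0 := H3_gt0 hy.
rewrite ler_pdivlMr ?sqrtr_gt0 ?mulr_gt0 // mul1r.
rewrite -(@ler_pXn2r _ 2) ?nnegrE ?sqrtr_ge0 ?(ltW (dot_lt1 _ _)) //.
rewrite sqr_sqrtr; last by rewrite mulr_ge0 ?ltW.
apply: le_trans (reverse_cauchy_schwarz x y).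
by rewrite lerDl mulr_ge0 ?dot_ge0 // ltW.
Qed.

Lemma ler_arcosh a b : 1 <= a -> a <= b -> arcosh a <= arcosh b.
Proof.
move=> a1 ab; have b1 := le_trans a1 ab.
have pos c : 1 <= c -> 0 < c + Num.sqrt (c ^+ 2 - 1).
  by move=> c1; rewrite ltr_wpDr ?sqrtr_ge0 // (lt_le_trans ltr01).
rewrite /arcosh ler_ln ?posrE ?pos //; apply: lerD => //.
by apply: ler_wsqrtr; nra.
Qed.

Lemma expR_arcosh a : 1 <= a -> expR (arcosh a) = a + Num.sqrt (a ^+ 2 - 1).
Proof.
move=> a1; rewrite /arcosh lnK // posrE ltr_wpDr ?sqrtr_ge0 //.
exact: lt_le_trans a1.
Qed.

Lemma H3_eq x z : H3 R x -> H3 R z ->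
  (1 - dot x z) ^+ 2 = (1 - dot x x) * (1 - dot z z) -> z = x.
Proof.
move=> hx hz e; have := reverse_cauchy_schwarz x z.
have x0 := H3_gt0 hx; rewrite e gerDl pmulr_rle0 // => le0.
apply/esym/eqP; rewrite -subr_eq0; apply/eqP/dot_eq0/eqP.
by rewrite eq_le le0 dot_ge0.
Qed.

(* In the hyperboloid model, when [d(x,z) + d(z,y) = d(x,y)],
   [sinh d(x,y) * Z = sinh d(z,y) * X + sinh d(x,z) * Y]: the difference of the
   two sides is null and orthogonal to the timelike vector [Z]. *)
Lemma hsegment_affine x y z : H3 R x -> H3 R y -> hsegment x y z ->
  exists a b, [/\ 0 <= a, 0 <= b, a + b = 1 & z = a *: x + b *: y].
Proof.
move=> hx hy [hz]; rewrite /= /hdist.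
have X0 := H3_gt0 hx; have Y0 := H3_gt0 hy; have Z0 := H3_gt0 hz.
have A1 := cosh_hdist_ge1 hx hz; have B1 := cosh_hdist_ge1 hz hy.
have D1 := cosh_hdist_ge1 hx hy.
move: A1 B1 D1; rewrite !(sqrtrM _ (ltW X0)) !(sqrtrM _ (ltW Z0)).
set rx := Num.sqrt (1 - dot x x); set ry := Num.sqrt (1 - dot y y).
set rz := Num.sqrt (1 - dot z z).
have rx0 : 0 < rx by rewrite sqrtr_gt0.
have ry0 : 0 < ry by rewrite sqrtr_gt0.
have rz0 : 0 < rz by rewrite sqrtr_gt0.
have xx : dot x x = 1 - rx ^+ 2 by rewrite sqr_sqrtr ?ltW //; ring.
have yy : dot y y = 1 - ry ^+ 2 by rewrite sqr_sqrtr ?ltW //; ring.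
have zz : dot z z = 1 - rz ^+ 2 by rewrite sqr_sqrtr ?ltW //; ring.
set A := _ / (rx * rz); set B := _ / (rz * ry); set D := _ / (rx * ry).
have xz : dot x z = 1 - A * rx * rz.
  by rewrite /A; field; rewrite !gt_eqF.
have zy : dot z y = 1 - B * rz * ry.
  by rewrite /B; field; rewrite !gt_eqF.
have xy : dot x y = 1 - D * rx * ry.
  by rewrite /D; field; rewrite !gt_eqF.
clearbody A B D => A1 B1 D1 /(congr1 (@expR R)).
rewrite expRD !expR_arcosh //.
have sq c : 1 <= c -> 0 <= c ^+ 2 - 1 by move=> c1; nra.
set a := Num.sqrt (A ^+ 2 - 1); set b := Num.sqrt (B ^+ 2 - 1).
set d := Num.sqrt (D ^+ 2 - 1).
have a2 : a ^+ 2 = A ^+ 2 - 1 by apply: sqr_sqrtr; apply: sq.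
have b2 : b ^+ 2 = B ^+ 2 - 1 by apply: sqr_sqrtr; apply: sq.
have d2 : d ^+ 2 = D ^+ 2 - 1 by apply: sqr_sqrtr; apply: sq.
have a0 : 0 <= a by exact: sqrtr_ge0.
have b0 : 0 <= b by exact: sqrtr_ge0.
have d0 : 0 <= d by exact: sqrtr_ge0.
clearbody a b d => eqs.
(* [A] and [a] are the cosh and sinh of [d(x,z)], so [A - a] is the inverse of [A + a]. The
   conjugate identity turns the hypothesis into the addition formulas [De] and [de]. *)
have eqd : (A - a) * (B - b) = D - d.
  have Dd : D + d != 0 by rewrite gt_eqF //; lra.
  apply: (mulfI Dd); rewrite -{1}eqs.
  transitivity ((A ^+ 2 - a ^+ 2) * (B ^+ 2 - b ^+ 2)); first by ring.
  transitivity (D ^+ 2 - d ^+ 2); last by ring.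
  by rewrite a2 b2 d2; ring.
have De : D = A * B + a * b by lra.
have de : d = A * b + a * B by lra.
(* The general case divides by [d], the sinh of [d(x,y)]; if it vanishes, so does [d(x,z)], and
   [z = x]. *)
have [d_gt0|d_le0] := ltP 0 d; last first.
  have {}d0 : d = 0 by lra.
  have ab0 : 0 <= A * b by rewrite mulr_ge0 //; lra.
  have a_0 : a = 0.
    have : a * B <= 0 by lra.
    by rewrite pmulr_lle0 => [|]; lra.
  have AA : A = 1 by rewrite a_0 in a2; nra.
  exists 1, 0; split=> //; rewrite ?ler01 ?addr0 // scale0r addr0 scale1r.
  by apply: (H3_eq hx hz); rewrite xz xx zz AA; ring.
(* Space and time components of the difference, the point of the hyperboloid over [z] being
   [(1, z) / rz]. *)
pose v := (d / rz) *: z - (b / rx) *: x - (a / ry) *: y.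
pose v0 := d / rz - b / rx - a / ry.
have vz : dot v z = v0.
  rewrite /v /v0 !dot_linE (dotC y z) xz zy zz de; field.
  by rewrite !gt_eqF.
have vv : dot v v = v0 ^+ 2.
  rewrite /v /v0 !dot_linE (dotC y z) (dotC y x) (dotC z x) xz zy zz xx xy yy.
  apply/eqP; rewrite -subr_eq0; apply/eqP.
  transitivity (- d ^+ 2 - b ^+ 2 - a ^+ 2 + d * b * A *+ 2 + d * a * B *+ 2
    - a * b * D *+ 2).
    by field; rewrite !gt_eqF.
  rewrite De de.
  transitivity (b ^+ 2 * (A ^+ 2 - 1) + a ^+ 2 * (B ^+ 2 - 1)
    - (a ^+ 2 * b ^+ 2) *+ 2); first by ring.
  by rewrite -a2 -b2; ring.
have v00 : v0 = 0.
  have := cauchy_schwarz v z; rewrite vv vz zz.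
  rewrite -subr_ge0 (_ : _ - _ = - (v0 * rz) ^+ 2); last by ring.
  rewrite oppr_ge0 => h; have /eqP : (v0 * rz) ^+ 2 = 0.
    by apply/eqP; rewrite eq_le h sqr_ge0.
  by rewrite sqrf_eq0 mulf_eq0 (gt_eqF rz0) orbF => /eqP.
have v_0 : v = 0 by apply: dot_eq0; rewrite vv v00 expr0n.
have rzd : rz * d^-1 * (d / rz) = 1 by field; rewrite !gt_eqF.
exists (rz * d^-1 * (b / rx)), (rz * d^-1 * (a / ry)); split.
- by rewrite !(mulr_ge0, divr_ge0, invr_ge0) // ltW.
- by rewrite !(mulr_ge0, divr_ge0, invr_ge0) // ltW.
- rewrite -mulrDr (_ : b / rx + a / ry = d / rz) //.
  by move: v00; rewrite /v0; lra.
- have e : (d / rz) *: z = (b / rx) *: x + (a / ry) *: y.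
    by apply/eqP; rewrite -subr_eq0 opprD addrA; apply/eqP.
  by rewrite -[LHS]scale1r -rzd -[LHS]scalerA e scalerDr !scalerA.
Qed.

End Vectors.

(** * Convex hulls and their boundary components *)

Section Hull.
Variable R : realType.
Implicit Types (u v w x y z n p q : 'rV[R]_3) (a b c : R) (C K : set 'rV[R]_3).

Lemma cvg_row3 (T : Type) (G : set_system T) (F : T -> 'rV[R]_3)
    (l : 'rV[R]_3) :
  Filter G -> (F t 0 0 @[t --> G] --> l 0 0) ->
  (F t 0 1 @[t --> G] --> l 0 1) -> (F t 0 2 @[t --> G] --> l 0 2) ->
  F @ G --> l.
Proof.
move=> FG h0 h1 h2 A [P nP sPA].
have n0 := h0 _ (nP 0 0); have n1 := h1 _ (nP 0 1); have n2 := h2 _ (nP 0 2).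
near=> t; apply: sPA => i j; rewrite ord1; case: j => -[|[|[|//]]] j3.
- rewrite (_ : Ordinal j3 = 0); last exact: val_inj.
  by near: t; exact: n0.
- rewrite (_ : Ordinal j3 = 1); last exact: val_inj.
  by near: t; exact: n1.
- rewrite (_ : Ordinal j3 = 2); last exact: val_inj.
  by near: t; exact: n2.
Unshelve. all: by end_near. Qed.

Lemma continuous_row3 (T : topologicalType) (F : T -> 'rV[R]_3) :
  continuous (fun t => F t 0 0) -> continuous (fun t => F t 0 1) ->
  continuous (fun t => F t 0 2) -> continuous F.
Proof. by move=> h0 h1 h2 t; apply: cvg_row3;
  [exact: h0|exact: h1|exact: h2]. Qed.

Lemma continuous_dot (T : topologicalType) (f g : T -> 'rV[R]_3) :
  continuous f -> continuous g -> continuous (fun t => dot (f t) (g t)).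
Proof.
move=> cf cg; rewrite (_ : (fun t => _) = (fun t => f t 0 0 * g t 0 0
  + f t 0 1 * g t 0 1 + f t 0 2 * g t 0 2)); last first.
  by apply/funext => t; rewrite dotE.
move=> t; have coord (h : T -> 'rV[R]_3) i : continuous h ->
    {for t, continuous (fun s => h s 0 i)}.
  move=> ch; apply: (@continuous_comp _ _ _ h (fun v : 'rV[R]_3 => v 0 i) t).
      exact: ch.
    exact: coord_continuous.
by apply: cvgD; first apply: cvgD; apply: cvgM; exact: coord.
Qed.

Lemma closed_dot_le n c : closed [set x | dot n x <= c].
Proof.
apply: (@closed_comp _ _ (dot n) [set r | r <= c]); last exact: closed_le.
by move=> x _; apply: continuous_dot; [exact: cst_continuous|move=> y;
  exact: cvg_id].
Qed.

(** * Segments and paths in the closed ball *)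

Definition lerp x y t : 'rV[R]_3 := (1 - t) *: x + t *: y.

Lemma lerp0 x y : lerp x y 0 = x.
Proof. by rewrite /lerp subr0 scale1r scale0r addr0. Qed.

Lemma lerp1 x y : lerp x y 1 = y.
Proof. by rewrite /lerp subrr scale1r scale0r add0r. Qed.

Lemma continuous_lerp x y : continuous (lerp x y).
Proof.
by move=> t; apply: cvgD; apply: cvgZr_tmp; [apply: cvgB;
  first exact: cvg_cst|];
  exact: cvg_id.
Qed.

Lemma dot_lerp n x y t : dot n (lerp x y t) = (1 - t) * dot n x + t * dot n y.
Proof. by rewrite !dot_linE. Qed.

Lemma dot_lerp_lerp x y t : 1 - dot (lerp x y t) (lerp x y t) =
  (1 - t) ^+ 2 * (1 - dot x x) + t ^+ 2 * (1 - dot y y)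
  + (t * (1 - t) * (1 - dot x y)) *+ 2.
Proof. by rewrite !dot_linE (dotC y x); ring. Qed.

Lemma dot_le1 x y : dot x x <= 1 -> dot y y <= 1 -> dot x y <= 1.
Proof.
by move=> x1 y1; have := dot_ge0 (x - y); rewrite !dot_linE (dotC y x); lra.
Qed.

Lemma lerp_ball x y t : dot x x <= 1 -> dot y y <= 1 -> 0 <= t <= 1 ->
  dot (lerp x y t) (lerp x y t) <= 1.
Proof.
move=> x1 y1 /andP[t0 t1]; have xy1 := dot_le1 x1 y1.
rewrite -subr_ge0 dot_lerp_lerp.
have := mulr_ge0 (sqr_ge0 (1 - t)) (_ : 0 <= 1 - dot x x).
have := mulr_ge0 (sqr_ge0 t) (_ : 0 <= 1 - dot y y).
have t2 : 0 <= t * (1 - t) by rewrite mulr_ge0 //; lra.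
have := mulr_ge0 t2 (_ : 0 <= 1 - dot x y).
rewrite !subr_ge0 => /(_ xy1) h1 /(_ y1) h2 /(_ x1) h3; lra.
Qed.

Lemma lerp_H3 x y t : dot x x <= 1 -> H3 R y -> 0 < t <= 1 -> H3 R (lerp x y t).
Proof.
move=> x1 y1 /andP[t0 t1]; have xy1 := dot_le1 x1 (ltW y1).
rewrite /H3 /= -subr_gt0 dot_lerp_lerp.
have := mulr_ge0 (sqr_ge0 (1 - t)) (_ : 0 <= 1 - dot x x).
have := mulr_gt0 (exprn_gt0 2 t0) (H3_gt0 y1).
have t2 : 0 <= t * (1 - t) by rewrite mulr_ge0 //; lra.
have := mulr_ge0 t2 (_ : 0 <= 1 - dot x y).
rewrite !subr_ge0 => /(_ xy1) h1 h2 /(_ x1) h3; lra.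
Qed.

Lemma ball_H3_CP1 x : (H3 R `|` CP1 R) x <-> dot x x <= 1.
Proof.
rewrite /H3 /CP1 /= le_eqVlt; split=> [[->|->]|/orP[/eqP|]];
  rewrite ?orbT ?eqxx;
by [|right|left].
Qed.

Lemma path_component (T : topologicalType) (A : set T) (f : R -> T) :
  continuous f -> (forall t, 0 <= t <= 1 -> A (f t)) ->
  connected_component A (f 0) (f 1).
Proof.
move=> cf Af; exists (f @` `[0, 1]); last first.
  by exists 1 => //=; rewrite in_itv /= ler01 lexx.
split.
- by exists 0 => //=; rewrite in_itv /= ler01 lexx.
- by move=> _ [t /= t01 <-]; apply: Af; rewrite in_itv in t01.
- apply: connected_continuous_connected; first exact: segment_connected.
  exact: continuous_subspaceT.
Qed.

Lemma lerp_component (A : set 'rV[R]_3) x y :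
  (forall t, 0 <= t <= 1 -> A (lerp x y t)) -> connected_component A x y.
Proof.
move=> h; have := path_component (@continuous_lerp x y) h.
by rewrite lerp0 lerp1.
Qed.

(** The exit time is the supremum of the times spent in [K]. Closedness is asked only along the
    path, since [CH C] is closed relative to [H3 R] and not in the closed ball. *)
Lemma last_exit K (f : R -> 'rV[R]_3) : continuous f -> K (f 0) -> ~ K (f 1) ->
  (forall t, 0 <= t <= 1 -> closure K (f t) -> K (f t)) ->
  exists t0, [/\ 0 <= t0 < 1, K (f t0) & forall t, t0 < t <= 1 -> ~ K (f t)].
Proof.
move=> cf K0 K1 clK; pose S := [set t | 0 <= t <= 1 /\ K (f t)].
have S0 : S 0 by split=> //; rewrite lexx ler01.
have S1 : ubound S 1 by move=> t [/andP[]].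
have supS : has_sup S by split; [exists 0|exists 1].
pose t0 := sup S.
have t0_ge0 : 0 <= t0 by apply: (sup_upper_bound supS).
have t0_le1 : t0 <= 1 by apply: (sup_le_ub (proj1 supS)).
have Kt0 : K (f t0).
  apply: clK; first by rewrite t0_ge0.
  move=> B /cf /nbhs_ballP [e e0 eB].
  have [s Ss ts] := sup_adherent e0 supS.
  exists (f s); split; first by case: Ss.
  apply: eB; rewrite /ball /= ger0_norm; first by rewrite ltrBlDr -ltrBlDl.
  by rewrite subr_ge0; exact: (sup_upper_bound supS).
exists t0; split=> //; first rewrite t0_ge0 lt_neqAle t0_le1 andbT /=.
  by apply/eqP => e; apply: K1; rewrite -e.
move=> t /andP[t0t t1] Kt; have : t <= t0.
  by apply: (sup_upper_bound supS); split=> //; rewrite t1 andbT; lra.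
by rewrite leNgt t0t.
Qed.

(** In the Klein model hyperbolic half-spaces are traces of Euclidean ones, so this is the convex
    hull seen from outside. It is a competitor in the intersection that defines [CH C]; hence an
    open half-space missing [C] misses [CH C]. *)
Definition dual_hull C : set 'rV[R]_3 := H3 R `&`
  [set x | forall n c, (forall q, C q -> dot n q <= c) -> dot n x <= c].

Lemma hclosed_dual_hull C : hclosed (dual_hull C).
Proof.
move=> x [clx hx]; split=> // n c Cnc.
apply: (@closed_dot_le n c x); apply: closureS clx => y [_ /=].
exact.
Qed.

Lemma hconvex_dual_hull C : hconvex (dual_hull C).
Proof.
move=> x y [hx Kx] [hy Ky] z hz; split; first by case: hz.
move=> n c Cnc; have [a [b [a0 b0 ab ->]]] := hsegment_affine hx hy hz.
have := Kx n c Cnc; have := Ky n c Cnc; rewrite !dot_linE => yc xc.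
have -> : c = a * c + b * c by rewrite -mulrDl ab mul1r.
by apply: lerD; exact: ler_wpM2l.
Qed.

Lemma norm_le_dot x : `|x| ^+ 2 <= dot x x.
Proof.
have [/eqP ->|x0] := boolP (x == 0); first by rewrite normr0 expr0n dot_ge0.
have [|[i j] /= e] := @mx_norm_neq0 _ _ _ x.
  by rewrite -[mx_norm x]/(`|x|) normr_eq0.
rewrite -[`|x|]/(mx_norm x) e {e}.
rewrite ord1 real_normK ?num_real // dotE -!expr2.
have h0 := sqr_ge0 (x 0 0); have h1 := sqr_ge0 (x 0 1).
have h2 := sqr_ge0 (x 0 2).
case: j => -[|[|[|//]]] j3.
- by rewrite (_ : Ordinal j3 = 0); [lra|exact: val_inj].
- by rewrite (_ : Ordinal j3 = 1); [lra|exact: val_inj].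
- by rewrite (_ : Ordinal j3 = 2); [lra|exact: val_inj].
Qed.

(** A point [p] of the sphere off [C] is cut off by a half-space of normal [p]. A point [q] of [C]
    is approached along the chord to another point of [C], whence the two distinct points: over a
    single point the hull is empty. *)
Lemma accumulation_dual_hull C q1 q2 : C `<=` CP1 R -> closed C ->
  C q1 -> C q2 -> q1 <> q2 -> accumulation_at_infinity (dual_hull C) = C.
Proof.
move=> C1 clC Cq1 Cq2 q12; apply/seteqP; split=> [p [clp p1]|q Cq].
  apply: contrapT => nCp.
  have /nbhs_ballP [e e0 eC] : nbhs p (~` C).
    by apply: open_nbhs_nbhs; split=> //; exact: closed_openC.
  (* For unit vectors [dot p q] is 1 minus half the squared Euclidean distance, and the latter
     dominates the squared sup norm. *)
  have far q : C q -> dot p q <= 1 - e ^+ 2 / 2.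
    move=> Cq; have : e <= `|p - q|.
      rewrite leNgt; apply/negP => pq.
      by have : (~` C) q; [apply: eC; rewrite -ball_normE|exact].
    rewrite -(ler_pXn2r (_ : 0 < 2)%N) ?nnegrE ?(ltW e0) // => eq2.
    have := le_trans eq2 (norm_le_dot _).
    rewrite !dot_linE (dotC q p) [dot p p]p1 [dot q q](C1 _ Cq); lra.
  have : dot p p <= 1 - e ^+ 2 / 2.
    apply: (@closed_dot_le p _ p); apply: closureS clp => y [_ /=].
    by apply; exact: far.
  by rewrite [dot p p]p1; have := exprn_gt0 2 e0; lra.
split; last exact: C1.
have [r Cr rq] : exists2 r, C r & r <> q.
  have [e|ne] := pselect (q1 = q); last by exists q1.
  by exists q2 => // e'; apply: q12; rewrite e e'.
have qr1 : dot q r < 1.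
  have : dot (q - r) (q - r) != 0.
    by apply/eqP => /dot_eq0 /eqP; rewrite subr_eq0 => /eqP /esym.
  have := dot_ge0 (q - r); rewrite le_eqVlt eq_sym => /orP[/eqP -> /eqP//|].
  by rewrite !dot_linE (dotC r q) [dot q q](C1 _ Cq) [dot r r](C1 _ Cr); lra.
move=> B nB; have nB0 : nbhs (lerp q r 0) B by rewrite lerp0.
have := @continuous_lerp q r 0 B nB0 => /nbhs_ballP [e /= e0 eB].
pose t := Num.min (e / 2) (1 / 2).
have t0 : 0 < t by rewrite lt_min !divr_gt0.
have te : t < e by rewrite gt_min ltr_pdivrMr //; apply/orP; left; lra.
have t1 : t <= 1 / 2 by rewrite ge_min lexx orbT.
exists (lerp q r t); split; last first.
  by apply: eB; rewrite /ball /= sub0r normrN gtr0_norm.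
split=> [|n c Cnc].
  rewrite /H3 /= -subr_gt0 dot_lerp_lerp [dot q q](C1 _ Cq) [dot r r](C1 _ Cr).
  rewrite subrr !mulr0 !add0r pmulrn_lgt0 // !mulr_gt0 ?subr_gt0 //; lra.
rewrite dot_lerp.
have -> : c = (1 - t) * c + t * c by ring.
by apply: lerD; apply: ler_wpM2l; rewrite ?subr_ge0; try lra; exact: Cnc.
Qed.

Lemma CH_sub_dual_hull C q1 q2 : C `<=` CP1 R -> closed C ->
  C q1 -> C q2 -> q1 <> q2 -> CH C `<=` dual_hull C.
Proof.
move=> C1 clC Cq1 Cq2 q12 x; apply; split=> /=.
- by move=> y [].
- exact: hclosed_dual_hull.
- exact: hconvex_dual_hull.
- exact: accumulation_dual_hull Cq1 Cq2 q12.
Qed.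

Lemma hclosed_CH C : hclosed (CH C).
Proof.
move=> x [clx hx] K hK; have [_ clK _ _] := hK; apply: clK; split=> //.
by apply: closureS clx => y /(_ _ hK).
Qed.

(* The last point in the hull of the segment from [x] to [p] faces the
   component of [q], because [q] and [p]
     lie in a common cap missing the hull. *)
Lemma boundaryCH_lerp C (Omega : set 'rV[R]_3) x p q n c :
  C `<=` CP1 R -> CH C `<=` dual_hull C -> CH C x ->
  (forall r, C r -> dot n r <= c) -> Omega q -> CP1 R q -> c < dot n q ->
  H3 R p -> c < dot n p ->
  exists2 t, 0 <= t <= 1 & boundaryCH C Omega (lerp x p t).
Proof.
move=> C1 CHK CHx Cnc Oq q1 cq p1 cp.
have out y : c < dot n y -> ~ (CH C `|` C) y.
  move=> cy [/CHK[_ /(_ n c Cnc)]|/Cnc]; by rewrite leNgt cy.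
have x1 : H3 R x by case: (CHK _ CHx).
have [|||t [t01 CHt outt]] :=
    @last_exit (CH C) (lerp x p) (@continuous_lerp x p).
- by rewrite lerp0.
- by rewrite lerp1 => CHp; apply: (out p cp); left.
- move=> t t01 clt; apply: hclosed_CH; split=> //.
  case/andP: t01; rewrite le_eqVlt => /orP[/eqP <- _|t0 t1].
    by rewrite lerp0.
  by apply: lerp_H3; rewrite ?(ltW x1) ?t0.
exists t; first by lra.
split=> // B nB; have := @continuous_lerp x p t _ nB.
move=> /nbhs_ballP [e /= e0 eB].
(* A point just beyond the last exit: it is joined to [p] along the rest of the segment, and [p] to
   [q] inside the cap, both outside the hull and [C]. *)
pose s := Num.min (t + e / 2) 1.
have ts : t < s by rewrite lt_min; apply/andP; split; lra.
have s1 : s <= 1 by rewrite ge_min lexx orbT.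
have se : s < t + e by rewrite gt_min; apply/orP; left; lra.
exists (lerp x p s); split; last first.
  by apply: eB; rewrite /ball /= distrC gtr0_norm ?subr_gt0 // ltrBlDl.
exists q => //; apply: (@connected_component_trans _ _ p).
  apply: lerp_component => r /andP[r0 r1]; split.
    by apply/ball_H3_CP1; apply: lerp_ball;
      rewrite ?r0 ?(ltW p1) // [dot q q]q1.
  apply: out; rewrite dot_lerp.
  have -> : c = (1 - r) * c + r * c by ring.
  have [r_0|r_gt0] := leP r 0; last first.
    by apply: ler_ltD; [apply: ler_wpM2l; lra|rewrite ltr_pM2l].
  have -> : r = 0 by lra.
  by rewrite !mul0r !addr0 subr0 !mul1r.
apply: connected_component_sym.
have := @path_component _ ((H3 R `|` CP1 R) `\` (CH C `|` C))
  (fun r => lerp x p ((1 - r) * s + r * 1)).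
rewrite mul0r subr0 mul1r addr0 subrr mul0r mulr1 add0r lerp1; apply.
  move=> r; apply: continuous_comp; last exact: continuous_lerp.
  apply: cvgD; apply: cvgM; try exact: cvg_cst; try exact: cvg_id.
  by apply: cvgB; [exact: cvg_cst|exact: cvg_id].
move=> r /andP[r0 r1]; set m := (_ + _ : R).
have sm : s <= m by rewrite /m; nra.
have m1 : m <= 1 by rewrite /m; nra.
have hm : H3 R (lerp x p m) by apply: lerp_H3; rewrite ?(ltW x1) //; lra.
split; first by left.
move=> [|/C1]; first by apply: outt; lra.
by move=> e1; move: hm; rewrite /H3 /= e1 ltxx.
Qed.

(** Hyperbolic balls are convex: as [z] moves along the segment, [1 - dot x z] is affine while
    [Num.sqrt (1 - dot z z)] is concave, by the reverse Cauchy-Schwarz inequality. *)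
Lemma hdist_lerp x p t c : H3 R x -> H3 R p -> 0 <= t <= 1 -> 1 <= c ->
  1 - dot x p <= c * Num.sqrt (1 - dot x x) * Num.sqrt (1 - dot p p) ->
  hdist x (lerp x p t) <= arcosh c.
Proof.
move=> hx hp /andP[t0 t1] c1; have X0 := H3_gt0 hx; have P0 := H3_gt0 hp.
have hy : H3 R (lerp x p t).
  move: t0; rewrite le_eqVlt => /orP[/eqP <-|t0]; first by rewrite lerp0.
  by apply: lerp_H3; rewrite ?t0 // ltW.
have Y0 := H3_gt0 hy.
have := reverse_cauchy_schwarz x p.
have sX := sqr_sqrtr (ltW X0); have sP := sqr_sqrtr (ltW P0).
move: (dot_lt1 hx hp) => xp0.
have rx0 : 0 < Num.sqrt (1 - dot x x) by rewrite sqrtr_gt0.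
have rp0 : 0 < Num.sqrt (1 - dot p p) by rewrite sqrtr_gt0.
move=> rc le_c.
apply: ler_arcosh; first exact: cosh_hdist_ge1.
rewrite (sqrtrM _ (ltW X0)) ler_pdivrMr; last by rewrite mulr_gt0 ?sqrtr_gt0.
move: rc sX sP rx0 rp0 le_c.
set rx := Num.sqrt (1 - dot x x); set rp := Num.sqrt (1 - dot p p).
move=> rc sX sP rx0 rp0 le_c.
have xp : rx * rp <= 1 - dot x p.
  rewrite -(ler_pXn2r (_ : 0 < 2)%N) ?nnegrE ?mulr_ge0 ?(ltW rx0) ?(ltW rp0)
    ?(ltW xp0) // exprMn sX sP; apply: le_trans rc.
  by rewrite lerDl mulr_ge0 ?dot_ge0 ?(ltW X0).
have ry : (1 - t) * rx + t * rp
    <= Num.sqrt (1 - dot (lerp x p t) (lerp x p t)).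
  have s0 : 0 <= (1 - t) * rx + t * rp.
    by rewrite addr_ge0 // mulr_ge0 ?subr_ge0 ?(ltW rx0) ?(ltW rp0).
  rewrite -(ger0_norm s0) -sqrtr_sqr ler_wsqrtr // dot_lerp_lerp -sX -sP.
  have := ler_wpM2l (_ : 0 <= t * (1 - t)) xp.
  by rewrite mulr_ge0 ?subr_ge0 // => /(_ isT); nra.
rewrite dot_lerp.
have -> : 1 - ((1 - t) * dot x x + t * dot x p)
  = (1 - t) * (1 - dot x x) + t * (1 - dot x p) by ring.
rewrite -sX.
apply: (@le_trans _ _ (c * rx * ((1 - t) * rx + t * rp))); last first.
  by rewrite mulrA ler_pM2l // mulr_gt0 //; lra.
have := ler_wpM2l t0 le_c.
have : (1 - t) * rx ^+ 2 <= c * ((1 - t) * rx ^+ 2).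
  by rewrite ler_peMl // mulr_ge0 ?subr_ge0 ?sqr_ge0.
lra.
Qed.

Lemma hdist_set_boundaryCH C (Omega : set 'rV[R]_3) x p q n c d :
  C `<=` CP1 R -> CH C `<=` dual_hull C -> CH C x ->
  (forall r, C r -> dot n r <= c) -> Omega q -> CP1 R q -> c < dot n q ->
  H3 R p -> c < dot n p -> 1 <= d ->
  1 - dot x p <= d * Num.sqrt (1 - dot x x) * Num.sqrt (1 - dot p p) ->
  (hdist_set x (boundaryCH C Omega) <= (arcosh d)%:E)%E.
Proof.
move=> C1 CHK CHx Cnc Oq q1 cq p1 cp d1 led.
have [t t01 Bt] := boundaryCH_lerp C1 CHK CHx Cnc Oq q1 cq p1 cp.
apply: ereal_inf_le; exists (hdist x (lerp x p t))%:E.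
  by exists (lerp x p t).
by rewrite lee_fin; apply: hdist_lerp => //; case: (CHK _ CHx).
Qed.

End Hull.

(** * Upper half-space coordinates *)

Section Chart.
Variable R : realType.
Implicit Types (x p q n : 'rV[R]_3) (a b h w : R) (C : set 'rV[R]_3).

Lemma scale_rowE a x i : (a *: x) 0 i = a * x 0 i.
Proof. by rewrite mxE. Qed.

Definition vec3 a b w : 'rV[R]_3 := \row_i nth 0 [:: a; b; w] i.

Lemma vec3E0 a b w : vec3 a b w 0 0 = a. Proof. by rewrite mxE. Qed.
Lemma vec3E1 a b w : vec3 a b w 0 1 = b. Proof. by rewrite mxE. Qed.
Lemma vec3E2 a b w : vec3 a b w 0 2 = w. Proof. by rewrite mxE. Qed.

Definition vec3E := (vec3E0, vec3E1, vec3E2).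

(* Upper half-space coordinates: [chart a b h] is the point at height [h] above
   [a + i b], and [chart a b 0] is the inverse stereographic projection. *)
Definition chart a b h : 'rV[R]_3 :=
  (a ^+ 2 + b ^+ 2 + h ^+ 2 + 1)^-1 *:
  vec3 (2 * a) (2 * b) (a ^+ 2 + b ^+ 2 + h ^+ 2 - 1).

Definition stereo a b : 'rV[R]_3 := chart a b 0.

Definition north : 'rV[R]_3 := vec3 0 0 1.

Lemma chart_den_gt0 a b h : 0 < a ^+ 2 + b ^+ 2 + h ^+ 2 + 1.
Proof. by rewrite ltr_wpDl ?addr_ge0 ?sqr_ge0. Qed.

Lemma dot_chart a b h a' b' h' : 1 - dot (chart a b h) (chart a' b' h') =
  2 * ((a - a') ^+ 2 + (b - b') ^+ 2 + h ^+ 2 + h' ^+ 2) /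
  ((a ^+ 2 + b ^+ 2 + h ^+ 2 + 1) * (a' ^+ 2 + b' ^+ 2 + h' ^+ 2 + 1)).
Proof.
rewrite /chart dotZl dotZr dotE !vec3E.
have := chart_den_gt0 a b h; have := chart_den_gt0 a' b' h' => S1 S2.
by field; rewrite !gt_eqF.
Qed.

Lemma dot_north_north : dot north north = 1.
Proof. by rewrite dotE !vec3E; ring. Qed.

Lemma dot_chart_north a b h : 1 - dot north (chart a b h) =
  2 / (a ^+ 2 + b ^+ 2 + h ^+ 2 + 1).
Proof.
rewrite /chart dotZr dotE !vec3E; have := chart_den_gt0 a b h => S1.
by field; rewrite gt_eqF.
Qed.

Lemma chart_H3 a b h : 0 < h -> H3 R (chart a b h).
Proof.
move=> h0; rewrite /H3 /= -subr_gt0 dot_chart !subrr !expr0n /= !add0r.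
by rewrite divr_gt0 ?mulr_gt0 ?chart_den_gt0 // addr_gt0 ?exprn_gt0.
Qed.

Lemma stereo_CP1 a b : CP1 R (stereo a b).
Proof.
apply/esym/eqP; rewrite -subr_eq0 dot_chart !subrr !expr0n /= !add0r.
by rewrite mulr0 mul0r.
Qed.

Lemma sqrt_dot_chart a b h : 0 <= h ->
  Num.sqrt (1 - dot (chart a b h) (chart a b h)) =
  2 * h / (a ^+ 2 + b ^+ 2 + h ^+ 2 + 1).
Proof.
move=> h0; rewrite dot_chart !subrr !expr0n /= !add0r.
have := chart_den_gt0 a b h => S1.
rewrite (_ : _ / _ = (2 * h / (a ^+ 2 + b ^+ 2 + h ^+ 2 + 1)) ^+ 2); last first.
  by field; rewrite gt_eqF.
by rewrite sqrtr_sqr ger0_norm // divr_ge0 ?mulr_ge0 // ltW.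
Qed.

Lemma chart_surj x : dot x x <= 1 -> x <> north ->
  exists a b h, 0 <= h /\ x = chart a b h.
Proof.
move=> x1 xN.
have x2 : x 0 2 < 1.
  rewrite ltNge; apply/negP => le1; apply: xN; apply: row3P; rewrite !vec3E.
  move: x1; rewrite dotE -!expr2 => x1.
  have h0 := sqr_ge0 (x 0 0); have h1 := sqr_ge0 (x 0 1).
  by split; [apply/eqP; rewrite -sqrf_eq0; apply/eqP; nra..|nra].
have q0 : 0 < 1 - x 0 2 by rewrite subr_gt0.
have h2 : 0 <= 1 - dot x x by rewrite subr_ge0.
exists (x 0 0 / (1 - x 0 2)), (x 0 1 / (1 - x 0 2)),
  (Num.sqrt (1 - dot x x) / (1 - x 0 2)).
split; first by rewrite divr_ge0 ?sqrtr_ge0 // ltW.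
have -> : chart (x 0 0 / (1 - x 0 2)) (x 0 1 / (1 - x 0 2))
    (Num.sqrt (1 - dot x x) / (1 - x 0 2)) =
  ((1 - x 0 2) / 2) *: vec3 (2 * (x 0 0 / (1 - x 0 2)))
    (2 * (x 0 1 / (1 - x 0 2))) ((1 + x 0 2) / (1 - x 0 2) - 1).
  have e : (x 0 0 / (1 - x 0 2)) ^+ 2 + (x 0 1 / (1 - x 0 2)) ^+ 2 +
    (Num.sqrt (1 - dot x x) / (1 - x 0 2)) ^+ 2 = (1 + x 0 2) / (1 - x 0 2).
    rewrite !exprMn sqr_sqrtr // dotE; field; by rewrite gt_eqF.
  rewrite /chart e; congr (_ *: _); rewrite -[RHS]invf_div; congr (_^-1).
  by field; rewrite gt_eqF.
by apply: row3P; rewrite !scale_rowE !vec3E; split; field; rewrite gt_eqF.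
Qed.

Lemma chart_surj_H3 x : H3 R x -> exists a b h, 0 < h /\ x = chart a b h.
Proof.
move=> hx; have [||a [b [h [h0 e]]]] := @chart_surj x; first exact: ltW.
  by move=> e; move: hx; rewrite e /H3 /= dot_north_north ltxx.
exists a, b, h; split=> //; rewrite lt_neqAle h0 andbT; apply/eqP => h_0.
by have := stereo_CP1 a b; rewrite /stereo h_0 -e /CP1 /= => e1;
  move: hx; rewrite /H3 /= e1 ltxx.
Qed.

Lemma stereo_surj x : CP1 R x -> x <> north -> exists a b, x = stereo a b.
Proof.
move=> x1 xN; have [||a [b [h [h0 e]]]] := @chart_surj x => //.
  by rewrite [dot x x]x1.
exists a, b; rewrite e; congr chart; apply: contrapT => /eqP h_neq0.
have : H3 R x by rewrite e; apply: chart_H3; rewrite lt_neqAle eq_sym h_neq0.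
by rewrite /H3 /= [dot x x]x1 ltxx.
Qed.

(* The cap [cap_level < dot cap_normal] of the closed ball lies over the disc of
   centre [a + i b] and radius [h]. *)
Definition cap_normal a b h : 'rV[R]_3 :=
  vec3 (2 * a) (2 * b) (a ^+ 2 + b ^+ 2 - h ^+ 2 - 1).

Definition cap_level a b h : R := 1 + a ^+ 2 + b ^+ 2 - h ^+ 2.

Lemma dot_cap_chart a b h a' b' h' :
  dot (cap_normal a b h) (chart a' b' h') - cap_level a b h =
  2 * (h ^+ 2 - ((a' - a) ^+ 2 + (b' - b) ^+ 2 + h' ^+ 2)) /
  (a' ^+ 2 + b' ^+ 2 + h' ^+ 2 + 1).
Proof.
rewrite /chart /cap_normal /cap_level dotZr dotE !vec3E.
by have := chart_den_gt0 a' b' h' => S1; field; rewrite gt_eqF.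
Qed.

Lemma dot_cap_north a b h :
  dot (cap_normal a b h) north - cap_level a b h = - 2.
Proof. by rewrite /cap_normal /cap_level dotE !vec3E; ring. Qed.

Lemma cap_chart a b h a' b' h' :
  (cap_level a b h < dot (cap_normal a b h) (chart a' b' h')) =
  ((a' - a) ^+ 2 + (b' - b) ^+ 2 + h' ^+ 2 < h ^+ 2).
Proof.
rewrite -subr_gt0 dot_cap_chart pmulr_lgt0 ?invr_gt0 ?chart_den_gt0 //.
by rewrite pmulr_rgt0 // subr_gt0.
Qed.

Lemma cap_disjoint C a b h : C `<=` CP1 R ->
  (forall a' b', (a' - a) ^+ 2 + (b' - b) ^+ 2 < h ^+ 2 ->
    ~ C (stereo a' b')) ->
  forall q, C q -> dot (cap_normal a b h) q <= cap_level a b h.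
Proof.
move=> C1 disj q Cq; have [->|qN] := pselect (q = north).
  by rewrite -subr_le0 dot_cap_north; lra.
have [a' [b' e]] := stereo_surj (C1 _ Cq) qN; rewrite leNgt e cap_chart.
by apply/negP; rewrite expr0n addr0 => /disj; rewrite -e.
Qed.

Lemma edist_north a b : Defs.edist north (stereo a b) =
  2 / Num.sqrt (a ^+ 2 + b ^+ 2 + 1).
Proof.
rewrite /Defs.edist (_ : dot _ _ = 4 / (a ^+ 2 + b ^+ 2 + 1)).
  rewrite sqrtrM // (_ : 4 = 2 ^+ 2) ?sqrtr_sqr ?normr_nat ?sqrtrV //;
    last by ring.
  by rewrite !addr_ge0 ?sqr_ge0.
have := dot_chart_north a b 0; have := stereo_CP1 a b.
rewrite expr0n /= addr0 -/(stereo a b); move: (stereo a b) => s s1 e.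
rewrite !dot_linE dot_north_north (dotC s north) [dot s s]s1.
by transitivity (2 * (1 - dot north s)); [ring|rewrite e; ring].
Qed.

(* A two-sided corkscrew condition bounds the width: over any point of the hull
   at height [h] there is a point of the curve within [2 h], hence for each
   component a disc of radius [h] of that component at distance [O(h)]. *)
Lemma width_corkscrew C (M : R) q1 q2 : C `<=` CP1 R -> closed C ->
  C q1 -> C q2 -> q1 <> q2 -> 0 <= M ->
  (forall Omega, complementary_component C Omega ->
   forall a b h, C (stereo a b) -> 0 < h -> exists a' b',
   [/\ (a' - a) ^+ 2 + (b' - b) ^+ 2 <= M * h ^+ 2, Omega (stereo a' b')
     & forall a2 b2, (a2 - a') ^+ 2 + (b2 - b') ^+ 2 < h ^+ 2 ->
       ~ C (stereo a2 b2)]) ->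
  (width C < +oo)%E.
Proof.
move=> C1 clC Cq1 Cq2 q12 M0 cork.
have CHK := CH_sub_dual_hull C1 clC Cq1 Cq2 q12.
(* A bound for the cosh of the distance from [x], at height [h], to a point at height [h / 2] in the
   cap. With D the horizontal distance, the cosh is [(D^2 + 5h^2/4) / h^2], and [D^2] is at most
   [2 (2h)^2 + 2 M h^2]. *)
pose d := 2 * M + 10.
have d1 : 1 <= d by rewrite /d; lra.
suff near_side x (Omega : set 'rV[R]_3) : CH C x ->
    complementary_component C Omega ->
    (hdist_set x (boundaryCH C Omega) <= (arcosh d)%:E)%E.
  apply: (@le_lt_trans _ _ (arcosh d + arcosh d)%:E); last exact: ltry.
  apply: ge_ereal_sup => _ [x [U1 [U2 [CHx cU1 cU2 _ ->]]]].
  by rewrite EFinD; apply: leeD; exact: near_side.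
move=> CHx cO; have [hx Kx] := CHK _ CHx.
have [a [b [h [h0 ex]]]] := chart_surj_H3 hx.
have [a1 [b1 [C_1 ab1]]] : exists a1 b1, C (stereo a1 b1) /\
    (a1 - a) ^+ 2 + (b1 - b) ^+ 2 < (2 * h) ^+ 2.
  (* Otherwise the cap over the disc of radius [2 * h] misses the hull, although it contains [x],
     which has height [h]. *)
  apply: contrapT => nC.
  have /Kx : forall r, C r -> dot (cap_normal a b (2 * h)) r
      <= cap_level a b (2 * h).
    apply: cap_disjoint => // a1 b1 lt_ab Cab.
    by apply: nC; exists a1, b1.
  rewrite leNgt ex cap_chart !subrr expr0n /= !add0r => /negP; apply.
  by have := exprn_gt0 2 h0; nra.
have [a2 [b2 [ab2 Oab2 disj]]] := cork _ cO _ _ _ C_1 h0.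
have h20 : 0 < h / 2 by lra.
apply: (@hdist_set_boundaryCH _ C Omega x (chart a2 b2 (h / 2)) (stereo a2 b2)
  (cap_normal a2 b2 h) (cap_level a2 b2 h)) => //.
- exact: cap_disjoint.
- exact: stereo_CP1.
- by rewrite cap_chart !subrr expr0n /= !add0r exprn_gt0.
- exact: chart_H3.
- by rewrite cap_chart !subrr expr0n /= !add0r; nra.
rewrite ex (sqrt_dot_chart _ _ (ltW h0)) (sqrt_dot_chart _ _ (ltW h20))
  dot_chart.
set S := a ^+ 2 + _ + _ + 1; set S2 := a2 ^+ 2 + _ + _ + 1.
have S0 : 0 < S by exact: chart_den_gt0.
have S20 : 0 < S2 by exact: chart_den_gt0.
rewrite (_ : d * _ * _ = (2 * d * h ^+ 2) / (S * S2)); last first.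
  by field; rewrite !gt_eqF.
rewrite ler_pM2r ?invr_gt0 ?mulr_gt0 // /d.
have := sqr_ge0 ((a - a1) - (a1 - a2)); have := sqr_ge0 ((b - b1) - (b1 - b2)).
nra.
Qed.

End Chart.

(** * Oscillation near a point of a quasicircle *)

Section NotQuasicircle.
Variable R : realType.
Implicit Types (x y z p q : 'rV[R]_3) (C : set 'rV[R]_3).

Lemma chord_ge0 x y : 0 <= Defs.edist x y.
Proof. exact: sqrtr_ge0. Qed.

Lemma chord0 x : Defs.edist x x = 0.
Proof. by rewrite /Defs.edist subrr dotE !mxE !mulr0 !addr0 sqrtr0. Qed.

Lemma chord_eq0 x y : Defs.edist x y = 0 -> x = y.
Proof.
move=> /eqP; rewrite sqrtr_eq0 => le0.
apply/eqP; rewrite -subr_eq0; apply/eqP/dot_eq0/eqP.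
by rewrite eq_le le0 dot_ge0.
Qed.

Lemma chord_gt0 x y : x <> y -> 0 < Defs.edist x y.
Proof.
by move=> xy; rewrite lt_neqAle chord_ge0 andbT; apply/eqP => /esym /chord_eq0.
Qed.

Lemma continuous_edist x : continuous (Defs.edist x).
Proof.
move=> y; apply: (@continuous_comp _ _ _ (fun y => dot (x - y) (x - y))).
  have cB : continuous (fun y : 'rV[R]_3 => x - y).
    by move=> z; exact: (@cvgB _ _ _ (nbhs z) _ (fun=>
      x) id x z (cvg_cst _) cvg_id).
  exact: continuous_dot.
exact: sqrt_continuous.
Qed.

Lemma within_comp (T U V : topologicalType) (A : set T) (B : set U)
    (f : T -> U) (g : U -> V) :
  {within A, continuous f} -> {within B, continuous g} -> f @` A `<=` B ->
  {within A, continuous (g \o f)}.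
Proof.
move=> /subspace_continuousP cf /subspace_continuousP cg fAB.
apply/subspace_continuousP => t At W nW.
have Bft : B (f t) by apply: fAB; exists t.
have := cf t At _ (cg _ Bft W nW).
rewrite /nbhs /= /within /=; apply: filterS => s h As; apply: h => //.
by apply: fAB; exists s.
Qed.

Lemma edist_CP1 x y : CP1 R x -> CP1 R y ->
  Defs.edist x y ^+ 2 = 2 - 2 * dot x y.
Proof.
move=> x1 y1; rewrite sqr_sqrtr ?dot_ge0 // !dot_linE (dotC y x).
by rewrite [dot x x]x1 [dot y y]y1; ring.
Qed.

(** A point [y] of the circle is determined by [dot x y] and the determinant [e y] of [x] and [y].
    Equal distances fix the product, hence [e y] up to sign, and three points share two signs. *)
Lemma RP1_equidistant x y1 y2 y3 : RP1 R x -> RP1 R y1 -> RP1 R y2 ->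
  RP1 R y3 -> Defs.edist x y1 = Defs.edist x y2 ->
  Defs.edist x y1 = Defs.edist x y3 -> [\/ y1 = y2, y1 = y3 | y2 = y3].
Proof.
move=> [x1 x0] [y11 y10] [y21 y20] [y31 y30] e2 e3.
have d2 : dot x y1 = dot x y2.
  by have := edist_CP1 x1 y11; rewrite e2 (edist_CP1 x1 y21); lra.
have d3 : dot x y1 = dot x y3.
  by have := edist_CP1 x1 y11; rewrite e3 (edist_CP1 x1 y31); lra.
move: x1 x0 y11 y10 y21 y20 y31 y30 d2 d3; rewrite /CP1 /= !dotE.
move=> x1 x0 y11 y10 y21 y20 y31 y30; rewrite x0 !mul0r !addr0.
rewrite x0 mulr0 addr0 in x1; rewrite y10 mulr0 addr0 in y11.
rewrite y20 mulr0 addr0 in y21; rewrite y30 mulr0 addr0 in y31.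
set e := fun y => x 0 0 * y 0 2 - x 0 2 * y 0 0.
have coords y : x 0 0 * y 0 0 + x 0 2 * y 0 2 = x 0 0 * y1 0 0 + x 0 2 * y1 0 2
    -> e y = e y1 -> y 0 1 = 0 -> y = y1.
  rewrite /e => dy ey y0; apply: row3P; rewrite y0 y10; split=> //.
    transitivity (x 0 0 * (x 0 0 * y 0 0 + x 0 2 * y 0 2)
      - x 0 2 * (x 0 0 * y 0 2 - x 0 2 * y 0 0)).
      by transitivity ((x 0 0 * x 0 0 + x 0 2 * x 0 2) * y 0 0);
        [rewrite x1 mul1r|ring].
    rewrite dy ey.
    by transitivity ((x 0 0 * x 0 0 + x 0 2 * x 0 2) * y1 0 0);
      [ring|rewrite x1 mul1r].
  transitivity (x 0 2 * (x 0 0 * y 0 0 + x 0 2 * y 0 2)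
      + x 0 0 * (x 0 0 * y 0 2 - x 0 2 * y 0 0)).
    by transitivity ((x 0 0 * x 0 0 + x 0 2 * x 0 2) * y 0 2);
      [rewrite x1 mul1r|ring].
  rewrite dy ey.
  by transitivity ((x 0 0 * x 0 0 + x 0 2 * x 0 2) * y1 0 2);
    [ring|rewrite x1 mul1r].
have sq y : y 0 0 * y 0 0 + y 0 2 * y 0 2 = 1 ->
    e y ^+ 2 = 1 - (x 0 0 * y 0 0 + x 0 2 * y 0 2) ^+ 2.
  move=> y_1; rewrite /e; transitivity ((x 0 0 * x 0 0 + x 0 2 * x 0 2) *
    (y 0 0 * y 0 0 + y 0 2 * y 0 2) - (x 0 0 * y 0 0 + x 0 2 * y 0 2) ^+ 2).
    by ring.
  by rewrite x1 y_1 mul1r.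
have s1 := sq _ y11; have s2 := sq _ y21; have s3 := sq _ y31.
move=> d2 d3.
have /eqP : e y2 ^+ 2 = e y1 ^+ 2 by rewrite s1 s2 d2.
rewrite eqf_sqr => /orP[] /eqP e21.
  by constructor 1; apply/esym/coords => //; rewrite d2.
have /eqP : e y3 ^+ 2 = e y1 ^+ 2 by rewrite s1 s3 d3.
rewrite eqf_sqr => /orP[] /eqP e31.
  by constructor 2; apply/esym/coords => //; rewrite d3.
constructor 3; rewrite -e31 in e21; move: e21; rewrite /e => e21.
apply: row3P; rewrite y20 y30; split=> //.
  transitivity (x 0 0 * (x 0 0 * y2 0 0 + x 0 2 * y2 0 2)
      - x 0 2 * (x 0 0 * y2 0 2 - x 0 2 * y2 0 0)).
    by transitivity ((x 0 0 * x 0 0 + x 0 2 * x 0 2) * y2 0 0);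
      [rewrite x1 mul1r|ring].
  rewrite -d2 d3 e21.
  by transitivity ((x 0 0 * x 0 0 + x 0 2 * x 0 2) * y3 0 0);
    [ring|rewrite x1 mul1r].
transitivity (x 0 2 * (x 0 0 * y2 0 0 + x 0 2 * y2 0 2)
      + x 0 0 * (x 0 0 * y2 0 2 - x 0 2 * y2 0 0)).
  by transitivity ((x 0 0 * x 0 0 + x 0 2 * x 0 2) * y2 0 2);
    [rewrite x1 mul1r|ring].
rewrite -d2 d3 e21.
by transitivity ((x 0 0 * x 0 0 + x 0 2 * x 0 2) * y3 0 2);
  [ring|rewrite x1 mul1r].
Qed.

Lemma dilatation_bound (f : 'rV[R]_3 -> 'rV[R]_3) x (H : R) :
  (dilatation f x <= H%:E)%E -> exists2 d, 0 < d &
  forall y z, CP1 R y -> CP1 R z -> Defs.edist x y = Defs.edist x z ->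
    0 < Defs.edist x y < d ->
    Defs.edist (f x) (f y) / Defs.edist (f x) (f z) <= H + 1.
Proof.
move=> dH; have : (dilatation f x < (H + 1)%:E)%E.
  by apply: le_lt_trans dH _; rewrite lte_fin; lra.
move=> /ereal_inf_lt [_ [d d0 <-] sup_lt]; exists d => // y z y1 z1 yz yd.
rewrite -lee_fin; apply: le_trans (ltW sup_lt); apply: ereal_sup_ubound.
by exists y, z; split.
Qed.

(* [D] takes each small value once on [[0, 1/2]] and once on [[1/2, 1]], so it
   orders both halves. Where [D] agrees, the values of [r] are comparable;
     as [r]
   is monotone on one half, it cannot oscillate by an unbounded factor on the
   other. *)
Lemma level_set_comparison (D r : R -> R) (H d : R) :
  {within `[0, 1], continuous D} -> D 0 = 0 -> D 1 = 0 ->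
  (forall t, 0 < t < 1 -> 0 < D t) ->
  (forall t1 t2 t3, 0 < t1 -> t1 < t2 -> t2 < t3 -> t3 < 1 ->
    D t1 = D t2 -> D t1 = D t3 -> False) ->
  0 < d -> 0 <= H ->
  (forall t t', 0 < t < 1 -> 0 < t' < 1 -> D t = D t' -> D t < d ->
    r t <= H * r t') ->
  (forall t t', 1 / 2 <= t -> t <= t' -> t' <= 1 -> r t' <= r t) ->
  (forall K e : R, 0 < e -> exists s t : R, [/\ 0 < s, s < t, t < e &
    K * r t < r s]) ->
  False.
Proof.
move=> cD D_0 D_1 D_gt0 three d0 H0 comparable mono osc.
have pos t : 0 <= t <= 1 -> 0 < D t -> 0 < t < 1.
  move=> /andP[t0 t1] Dt; rewrite !lt_neqAle t0 t1 !andbT.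
  apply/andP; split; apply/eqP => e; move: Dt.
    by rewrite -e D_0 ltxx.
  by rewrite e D_1 ltxx.
have cDi a b : 0 <= a -> b <= 1 -> {within `[a, b], continuous D}.
  move=> a0 b1; apply: continuous_subspaceW cD => t /=; rewrite !in_itv /=.
  by move=> /andP[at_ tb]; rewrite (le_trans a0 at_) (le_trans tb b1).
have h0 : 0 < 1 / 2 :> R by rewrite divr_gt0.
have h1 : 1 / 2 < 1 :> R by rewrite ltr_pdivrMr // mul1r ltr1n.
have Dh : 0 < D (1 / 2) by apply: D_gt0; rewrite h0.
(* Levels below [D (1 / 2)] are attained on the second half as well, because [D 1 = 0]. *)
pose e := Num.min d (D (1 / 2)).
have e0 : 0 < e by rewrite lt_min d0.
have [eta eta0 small] : exists2 eta, 0 < eta & forall t, 0 <= t <= 1 ->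
    t < eta -> D t < e.
  move/subspace_continuousP : cD => /(_ 0) /=; rewrite in_itv /= lexx ler01.
  move=> /(_ isT (ball (D 0) e)) /=.
  move=> /(_ (nbhsx_ballx _ _ e0)); rewrite /nbhs /= /within /=.
  move=> /nbhs_ballP [a /= a0 aD]; exists a => // t t01 ta.
  have t0 : 0 <= t by case/andP: t01.
  have := aD t; rewrite /ball /= sub0r normrN ger0_norm //.
  rewrite in_itv /= => /(_ ta t01); rewrite D_0 sub0r normrN.
  by apply: le_lt_trans; exact: ler_norm.
have m0 : 0 < Num.min eta (1 / 2) by rewrite lt_min eta0.
(* The square accounts for two comparisons: [s] with its partner [p] on the second half, and the
   partner [q] of [t] with [t]. *)
have [s [t [s0 st tm ostK]]] := osc (H ^+ 2) _ m0.
move: tm; rewrite lt_min => /andP[teta th].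
have sh := lt_trans st th; have t0 := lt_trans s0 st.
have t1 := lt_trans th h1; have s1 := lt_trans sh h1.
have t01 : 0 < t < 1 by rewrite t0.
have s01 : 0 < s < 1 by rewrite s0.
have := small t; rewrite (ltW t0) (ltW t1) => /(_ isT teta).
rewrite lt_min => /andP[Dtd Dth].
have := small s; rewrite (ltW s0) (ltW s1) => /(_ isT (lt_trans st teta)).
rewrite lt_min => /andP[Dsd Dsh].
have Dt := D_gt0 _ t01; have Ds := D_gt0 _ s01.
have arm2 v b : 1 / 2 <= b -> b <= 1 -> D b <= v -> v <= D (1 / 2) ->
    exists c, [/\ 1 / 2 <= c, c <= b & D c = v].
  move=> b1 b2 bv vh; have [|||c] := @IVT R D (1 / 2) b v => //.
  - by apply: cDi => //; exact: ltW.
  - have bh := le_trans bv vh.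
    by rewrite (min_r bh) (max_l bh) bv.
  by rewrite in_itv /= => /andP[c1 c2] cv; exists c.
have [||q [q1 q2 eq]] := arm2 (D t) 1 (ltW h1) (lexx 1).
- by rewrite D_1 ltW.
- exact: ltW.
have [||p [p1 p2 ep]] := arm2 (D s) 1 (ltW h1) (lexx 1).
- by rewrite D_1 ltW.
- exact: ltW.
have q01 : 0 < q < 1.
  by apply: pos; [rewrite q2 andbT (le_trans (ltW h0) q1)|rewrite eq].
have p01 : 0 < p < 1.
  by apply: pos; [rewrite p2 andbT (le_trans (ltW h0) p1)|rewrite ep].
(* Were the order of the levels, here, or that of [q] and [p], below, reversed, intermediate values
   would yield a third point at level [D t]. *)
have Dst : D s < D t.
  rewrite ltNge; apply/negP => Dts.
  have [|||c] := @IVT R D 0 s (D t); first exact: ltW.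
  - by apply: cDi => //; exact: ltW.
  - by rewrite D_0 (min_l (ltW Ds)) (max_r (ltW Ds)) (ltW Dt).
  rewrite in_itv /= => /andP[c0 cs] ec.
  have c01 : 0 < c < 1.
    by apply: pos; rewrite ?ec // c0 (le_trans cs (ltW s1)).
  case/andP: c01 => c_gt0 _; case/andP: q01 => _ q_lt1.
  apply: (@three c t q) => //; rewrite ?ec ?eq //.
    exact: le_lt_trans cs st.
  exact: lt_le_trans th q1.
have qp : q <= p.
  rewrite leNgt; apply/negP => pq.
  have [||c [c1 c2 ec]] := arm2 (D t) p p1 p2.
  - by rewrite ep ltW.
  - exact: ltW.
  case/andP: q01 => _ q_lt1.
  apply: (@three t c q) => //; rewrite ?ec ?eq //.
    exact: lt_le_trans th c1.
  exact: le_lt_trans c2 pq.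
have r1 : r s <= H * r p by apply: comparable; rewrite ?ep.
have r2 : r q <= H * r t by apply: comparable; rewrite ?eq.
have r4 := ler_wpM2l H0 (le_trans (mono _ _ q1 qp p2) r2).
by move: ostK; rewrite ltNge expr2 -mulrA => /negP; apply; exact: le_trans r4.
Qed.

(* The distance to [p] is transported to a circle by the inverse of the
   quasiconformal map: every level set has at most two points on the circle, and
   the dilatation at the preimage of [p]
     makes chordal distances comparable along
   it. *)
Lemma oscillating_not_quasicircle C p (gamma : R -> 'rV[R]_3) :
  {within `[0, 1], continuous gamma} -> gamma 0 = p -> gamma 1 = p ->
  {in `[0, 1[ &, injective gamma} -> C = gamma @` `[0, 1] -> C `<=` CP1 R ->
  (forall t t', 1 / 2 <= t -> t <= t' -> t' <= 1 ->
    Defs.edist p (gamma t') <= Defs.edist p (gamma t)) ->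
  (forall K d : R, 0 < d -> exists s t : R, [/\ 0 < s, s < t, t < d &
    K * Defs.edist p (gamma t) < Defs.edist p (gamma s)]) ->
  ~ quasicircle C.
Proof.
move=> cgamma gamma0 gamma1 gammaI Cgamma C1 mono osc.
move=> [f [[cf [g [cg fg]]] [H dilH]] Cf].
have oo_cc (t : R) : 0 < t < 1 -> 0 <= t <= 1.
  by case/andP=> /ltW -> /ltW ->.
have Cgam (t : R) : 0 <= t <= 1 -> C (gamma t).
  by move=> t01; rewrite Cgamma; exists t => //=; rewrite in_itv.
have gam1 (t : R) : 0 <= t <= 1 -> CP1 R (gamma t) by move=> /Cgam /C1.
have I0 : 0 <= (0 : R) <= 1 by rewrite lexx ler01.
have gRP q : C q -> RP1 R (g q).
  rewrite Cf => -[y RPy <-]; have [CPy _] := RPy.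
  by have [_ _ -> _] := fg _ CPy.
have p1 : CP1 R p by rewrite -gamma0; exact: gam1.
have fgK q : CP1 R q -> f (g q) = q by move=> /fg[].
pose x := g p; have fx : f x = p by exact: fgK.
have xRP : RP1 R x by apply: gRP; rewrite -gamma0; exact: Cgam.
have x1 : CP1 R x by case: xRP.
pose D := (Defs.edist x \o g) \o gamma.
have gam_in (t : R) : 0 < t < 1 -> gamma t <> p.
  move=> t01; rewrite -gamma0 => /gammaI; rewrite !in_itv /= lexx ltr01.
  case/andP: t01 => t0 t1; rewrite (ltW t0) t1 => /(_ isT isT) e.
  by rewrite e ltxx in t0.
have D_gt0 (t : R) : 0 < t < 1 -> 0 < D t.
  move=> t01; apply: chord_gt0 => e; apply: (gam_in _ t01).
  by rewrite -fx e fgK //; exact/gam1/oo_cc.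
have [d d0 qs] := dilatation_bound (dilH _ x1).
(* The comparison constant has to be nonnegative, whence the absolute value of [H + 1]. *)
apply: (@level_set_comparison D (fun t =>
  Defs.edist p (gamma t)) `|H + 1| d) => //.
- apply: (@within_comp _ _ _ _ (CP1 R)) => //.
    apply: (@within_comp _ _ _ _ setT) => //.
    by apply: continuous_subspaceT; exact: continuous_edist.
  by move=> _ [t /= t01 <-]; apply: gam1; rewrite in_itv in t01.
- by rewrite /D /= gamma0 chord0.
- by rewrite /D /= gamma1 chord0.
- move=> t1 t2 t3 t1_0 t12 t23 t3_1 e2 e3.
  have t2_0 := lt_trans t1_0 t12; have t2_1 := lt_trans t23 t3_1.
  have t1_01 : 0 < t1 < 1 by rewrite t1_0 (lt_trans t12 t2_1).
  have t2_01 : 0 < t2 < 1 by rewrite t2_0.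
  have t3_01 : 0 < t3 < 1 by rewrite t3_1 (lt_trans t2_0 t23).
  have inj s t : 0 < s < 1 -> 0 < t < 1 -> g (gamma s) = g (gamma t) -> s = t.
    move=> s01 t01 /(congr1 f); rewrite !fgK; try exact/gam1/oo_cc.
    apply: gammaI; rewrite in_itv /=.
      by case/andP: s01 => /ltW -> ->.
    by case/andP: t01 => /ltW -> ->.
  have RPg (t : R) : 0 < t < 1 -> RP1 R (g (gamma t)).
    by move=> /oo_cc /Cgam /gRP.
  case: (RP1_equidistant xRP (RPg _ t1_01) (RPg _ t2_01) (RPg _ t3_01) e2 e3).
  + by move=> /(inj _ _ t1_01 t2_01) e; rewrite e ltxx in t12.
  + by move=> /(inj _ _ t1_01 t3_01) e; rewrite -e ltNge (ltW t12) in t23.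
  + by move=> /(inj _ _ t2_01 t3_01) e; rewrite e ltxx in t23.
move=> t t' t01 t'01 e Dtd; have Dt := D_gt0 _ t01.
have r0 : 0 < Defs.edist p (gamma t') by apply/chord_gt0/nesym/gam_in.
rewrite -ler_pdivrMr //; apply: le_trans (ler_norm _).
have [_ gt1 _ ft] := fg _ (gam1 _ (oo_cc _ t01)).
have [_ gt'1 _ ft'] := fg _ (gam1 _ (oo_cc _ t'01)).
by have := qs _ _ gt1 gt'1 e; rewrite fx ft ft'; apply; apply/andP.
Qed.

End NotQuasicircle.

(** * Jordan curves made of two arms *)

Section JordanArms.
Variable R : realType.
Implicit Types (s t : R).

(** A decreasing homeomorphism from the interval (0, 1/2) onto the line: parameters near 0
    correspond to [+oo], where an arm tends to its end [p]. *)
Definition unit_to_line t : R := (1 - 4 * t) / (1 - `|1 - 4 * t|).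
Definition line_to_unit s : R := (1 - s / (1 + `|s|)) / 4.

Lemma line_to_unitK : cancel line_to_unit unit_to_line.
Proof.
move=> s; rewrite /unit_to_line /line_to_unit.
have n0 : 0 < 1 + `|s| by rewrite ltr_pwDl.
rewrite (_ : 1 - 4 * _ = s / (1 + `|s|)); last by field; rewrite gt_eqF.
rewrite normrM normfV (gtr0_norm n0).
by field; rewrite (gt_eqF n0) (_ : 1 + `|s| - `|s| = 1) ?oner_neq0 //; ring.
Qed.

Lemma unit_to_line_den t : 0 < t < 1 / 2 -> 0 < 1 - `|1 - 4 * t|.
Proof. by move=> t01; rewrite subr_gt0 ltr_norml; lra. Qed.

Lemma unit_to_lineK t : 0 < t < 1 / 2 -> line_to_unit (unit_to_line t) = t.
Proof.
move=> /unit_to_line_den; rewrite /unit_to_line /line_to_unit.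
move=> n0; rewrite normrM normfV (gtr0_norm n0).
have n1 : 1 - `|1 - 4 * t| + `|1 - 4 * t| = 1 by ring.
by field; rewrite ?n1 ?oner_neq0 ?(gt_eqF n0).
Qed.

Lemma line_to_unit_decr s s' : s < s' -> line_to_unit s' < line_to_unit s.
Proof.
move=> ss'; rewrite /line_to_unit ltr_pM2r // ltrD2l ltrN2.
rewrite ltr_pdivrMr ?ltr_pwDl // mulrAC ltr_pdivlMr ?ltr_pwDl //.
case: (leP 0 s) => s0; case: (leP 0 s') => s'0;
  rewrite ?(ger0_norm s0) ?(ltr0_norm s0) ?(ger0_norm s'0) ?(ltr0_norm s'0);
  nra.
Qed.

Lemma line_to_unit_itv s : 0 < line_to_unit s < 1 / 2.
Proof.
have n0 : 0 < 1 + `|s| by rewrite ltr_pwDl.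
have : s / (1 + `|s|) < 1.
  by rewrite ltr_pdivrMr // mul1r; have := ler_norm s; lra.
have : - 1 < s / (1 + `|s|).
  rewrite ltr_pdivlMr // mulN1r ltrNl.
  by have := ler_norm (- s); rewrite normrN; lra.
by rewrite /line_to_unit; lra.
Qed.

Lemma unit_to_line_le t t' : 0 < t < 1 / 2 -> 0 < t' < 1 / 2 -> t <= t' ->
  unit_to_line t' <= unit_to_line t.
Proof.
move=> t0 t'0 tt'; rewrite leNgt; apply/negP => /line_to_unit_decr.
by rewrite !unit_to_lineK // ltNge tt'.
Qed.

Lemma line_to_unit_small d : 0 < d -> exists S, forall s, S < s ->
  line_to_unit s < d.
Proof.
move=> d0; exists (Num.max 0 (d^-1)) => s; rewrite gt_max => /andP[s0 ds].
rewrite /line_to_unit gtr0_norm //.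
have -> : (1 - s / (1 + s)) / 4 = (4 * (1 + s))^-1.
  by field; rewrite ?gt_eqF //; lra.
rewrite -[ltRHS]invrK ltf_pV2 ?posrE ?invr_gt0 //; lra.
Qed.

(** * Compactified arms and the loop that they form *)

Section Arc.
Variable V : normedModType R.
Implicit Types (p q : V) (alpha : R -> V).

Definition arc alpha p q t : V :=
  if t <= 0 then p else if 1 / 2 <= t then q else alpha (unit_to_line t).

Lemma arc0 alpha p q : arc alpha p q 0 = p.
Proof. by rewrite /arc lexx. Qed.

Lemma arc_half alpha p q : arc alpha p q (1 / 2) = q.
Proof. by rewrite /arc lexx leNgt divr_gt0. Qed.

Lemma arc_in alpha p q t : 0 < t < 1 / 2 ->
  arc alpha p q t = alpha (unit_to_line t).
Proof. by case/andP=> t0 t1; rewrite /arc leNgt t0 /= leNgt t1. Qed.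

(** Reversal exchanges the ends, so that continuity at [q] is deduced from continuity at [p]. *)
Lemma arc_rev alpha p q t :
  arc alpha p q (1 / 2 - t) = arc (alpha \o -%R) q p t.
Proof.
rewrite /arc (_ : (1 / 2 - t <= 0) = (1 / 2 <= t)); last by rewrite subr_le0.
rewrite (_ : (1 / 2 <= 1 / 2 - t) = (t <= 0)); last first.
  by rewrite lerBrDl gerDr.
case: (leP t 0) => t0; case: (leP (1 / 2) t) => t1 //.
  by exfalso; lra.
rewrite /= /unit_to_line (_ : 1 - 4 * (1 / 2 - t) = - (1 - 4 * t)); last by lra.
by rewrite normrN mulNr.
Qed.

Lemma arc_cvg_start alpha p q : alpha s @[s --> +oo] --> p ->
  arc alpha p q t @[t --> (0 : R)] --> p.
Proof.
move=> cp B nB; have [S [Sr SB]] := cp B nB.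
(* For small positive [t] one has [unit_to_line t = 1 / (4 * t) - 1], which exceeds [|S| + 1] as
   soon as [t < d]. *)
pose d := (4 * (`|S| + 2))^-1.
have n0 : 0 < `|S| + 2 by rewrite ltr_wpDl.
have d0 : 0 < d by rewrite invr_gt0 mulr_gt0.
have d4 : d <= 1 / 8.
  rewrite /d mul1r lef_pV2 ?posrE ?mulr_gt0 //.
  by have := normr_ge0 S; lra.
apply/nbhs_ballP; exists d => //= t; rewrite /ball /= sub0r normrN => td.
rewrite /arc; case: (leP t 0) => t0; first exact: nbhs_singleton.
rewrite gtr0_norm // in td.
rewrite leNgt (_ : t < 1 / 2) /=; last by lra.
apply: SB; rewrite /unit_to_line ger0_norm; last by lra.
rewrite (_ : 1 - (1 - 4 * t) = 4 * t); last by ring.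
rewrite ltr_pdivlMr ?mulr_gt0 //.
have : 4 * t * (`|S| + 2) < 1.
  have : t < (4 * (`|S| + 2))^-1 by [].
  rewrite -[(_ * _)^-1]mul1r ltr_pdivlMr ?mulr_gt0 //; lra.
have := ler_norm S.
nra.
Qed.

Lemma continuous_arc alpha p q : continuous alpha ->
  alpha s @[s --> +oo] --> p -> alpha s @[s --> -oo] --> q ->
  continuous (arc alpha p q).
Proof.
move=> ca cp cq.
have crev (t : R) (f : R -> V) :
    {for 1 / 2 - t, continuous f} -> {for t, continuous (fun u : R =>
      f (1 / 2 - u))}.
  move=> cf; apply: (@continuous_comp _ _ _ (fun u : R => 1 / 2 - u)) => //.
  by apply: cvgB; [exact: cvg_cst|exact: cvg_id].
have low (a : R -> V) p' q' (t : R) : a s @[s --> +oo] --> p' -> t <= 0 ->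
    {for t, continuous (arc a p' q')}.
  move=> cp'; rewrite le_eqVlt => /orP[/eqP ->|t0].
    by rewrite /prop_for /continuous_at arc0; exact: arc_cvg_start.
  rewrite /prop_for /continuous_at {2}/arc (ltW t0).
  apply: cvg_near_cst; near=> u.
   rewrite /arc (_ : u <= 0) //.
  by apply: ltW; near: u; exact: lt_nbhsl.
move=> t; have [t0|t0] := leP t 0; first exact: low.
have [t1|t1] := leP (1 / 2) t.
  have -> : arc alpha p q = (fun u : R => arc (alpha \o -%R) q p (1 / 2 - u)).
    by apply/funext => u; rewrite -arc_rev; congr arc; lra.
  apply: crev; apply: low; last by lra.
  exact: (cvgNy_compNP alpha (nbhs q)).1 cq.
have : {for t, continuous (alpha \o unit_to_line)}.
  apply: continuous_comp; last exact: ca.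
  have lin : {for t, continuous (fun u : R => 1 - 4 * u)}.
    apply: cvgB; first exact: cvg_cst.
    by apply: cvgM; [exact: cvg_cst|exact: cvg_id].
  apply: cvgM; first exact: lin.
  apply: cvgV; first by rewrite gt_eqF // unit_to_line_den // t0.
  apply: cvgB; first exact: cvg_cst.
  by apply: cvg_norm.
rewrite /prop_for /continuous_at /= arc_in ?t0 //.
apply: cvg_trans; apply: near_eq_cvg; near=> u.
rewrite arc_in //; apply/andP; split; near: u.
  exact: lt_nbhsr.
exact: lt_nbhsl.
Unshelve. all: by end_near. Qed.

Lemma arc_uniq alpha p q t t' : injective alpha -> p <> q ->
  (forall s, alpha s <> p) -> (forall s, alpha s <> q) ->
  0 <= t <= 1 / 2 -> 0 <= t' <= 1 / 2 ->
  arc alpha p q t = arc alpha p q t' -> t = t'.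
Proof.
move=> inj pq ap aq.
have cases (u : R) : 0 <= u <= 1 / 2 -> [\/ u = 0, u = 1 / 2 | 0 < u < 1 / 2].
  move=> /andP[u0 u1]; case: (ltgtP u 0) u0 => // [u0 _|->];
    last by constructor 1.
  case: (ltgtP u (1 / 2)) u1 => // [u1 _|->]; last by constructor 2.
  by constructor 3.
by move=> /cases[->|->|t0] /cases[->|->|t'0]; rewrite ?arc0 ?arc_half ?arc_in //
  => e; try (by move: (pq); rewrite ?e; case);
  try (by case: (ap _ e)); try (by case: (aq _ e));
  try (by case: (ap _ (esym e))); try (by case: (aq _ (esym e)));
  rewrite -[t]unit_to_lineK // -[t']unit_to_lineK // (inj _ _ e).
Qed.

Lemma arc_image alpha p q t : 0 <= t <= 1 / 2 ->
  [\/ arc alpha p q t = p, arc alpha p q t = q |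
      exists s, arc alpha p q t = alpha s].
Proof.
move=> _; rewrite /arc; case: leP => _; first by constructor 1.
by case: leP => _; [constructor 2|constructor 3; exists (unit_to_line t)].
Qed.

(** At every [t] at least one of the two arcs rests at [q]; adding them and subtracting [q] glues
    them without a case distinction, and continuity is inherited. *)
Definition loop alpha beta p q t : V :=
  arc alpha p q (Num.min t (1 / 2)) + arc beta p q (1 - Num.max t (1 / 2)) - q.

Lemma loop_low alpha beta p q t : t <= 1 / 2 ->
  loop alpha beta p q t = arc alpha p q t.
Proof.
move=> t1; rewrite /loop (min_l t1) (max_r t1).
by rewrite (_ : 1 - 1 / 2 = 1 / 2) ?arc_half ?addrK //; lra.
Qed.

Lemma loop_high alpha beta p q t : 1 / 2 <= t ->
  loop alpha beta p q t = arc beta p q (1 - t).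
Proof. by move=> t1; rewrite /loop (min_r t1) (max_l t1) arc_half addrC addKr.
  Qed.

Lemma continuous_loop alpha beta p q : continuous alpha -> continuous beta ->
  alpha s @[s --> +oo] --> p -> alpha s @[s --> -oo] --> q ->
  beta s @[s --> +oo] --> p -> beta s @[s --> -oo] --> q ->
  continuous (loop alpha beta p q).
Proof.
move=> ca cb ap aq bp bq t; apply: cvgB; last exact: cvg_cst.
have cmax : {for t, continuous (fun u : R => Num.max u (1 / 2))}.
  by apply: continuous_max; [exact: cvg_id|exact: cvg_cst].
apply: cvgD.
  apply: (@continuous_comp _ _ _ (fun u : R => Num.min u (1 / 2))); last first.
    exact: continuous_arc.
  by apply: continuous_min; [exact: cvg_id|exact: cvg_cst].
apply: (@continuous_comp _ _ _ (fun u : R => 1 - Num.max u (1 / 2)));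
  last first.
  exact: continuous_arc.
by apply: cvgB; [exact: cvg_cst|exact: cmax].
Qed.

Lemma loop_uniq alpha beta p q : injective alpha -> injective beta -> p <> q ->
  (forall s, [/\ alpha s <> p, alpha s <> q, beta s <> p & beta s <> q]) ->
  (forall s s', alpha s <> beta s') ->
  {in `[0, 1[ &, injective (loop alpha beta p q)}.
Proof.
move=> ia ib pq out ab.
have cross t t' : 0 <= t <= 1 / 2 -> 1 / 2 < t' < 1 ->
    arc alpha p q t <> arc beta p q (1 - t').
  move=> t0 t'0; rewrite [arc beta _ _ _]arc_in; last by lra.
  have [_ _ bp bq] := out (unit_to_line (1 - t')).
  have [->|->|[s ->]] := arc_image alpha p q t0; first exact: nesym.
    exact: nesym.
  exact: ab.
have outa s : alpha s <> p /\ alpha s <> q by have [] := out s.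
have outb s : beta s <> p /\ beta s <> q by have [] := out s.
move=> t t'; rewrite !in_itv /= => t01 t'01.
have [t1|t1] := leP t (1 / 2); have [t'1|t'1] := leP t' (1 / 2).
- rewrite !loop_low //; apply: arc_uniq => //; [by move=> s; case: (outa s)|
    by move=> s; case: (outa s)|lra|lra].
- by rewrite (loop_low _ _ _ _ t1) (loop_high _ _ _ _ (ltW t'1)) => /cross;
  case; lra.
- rewrite (loop_low _ _ _ _ t'1) (loop_high _ _ _ _ (ltW t1)) => /esym /cross.
  by case; lra.
- rewrite !loop_high ?ltW // => /arc_uniq e.
  have : 1 - t = 1 - t'.
    by apply: e => //; [move=> s; case: (outb s)|
      move=> s; case: (outb s)|lra|lra].
  by lra.
Qed.

Lemma loop_image alpha beta p q : loop alpha beta p q @` `[0, 1] =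
  [set p; q] `|` (range alpha `|` range beta).
Proof.
apply/seteqP; split=> [_ [t /= t01 <-]|v].
  move: t01; rewrite in_itv /= => t01.
  have [t1|/ltW t1] := leP t (1 / 2).
    rewrite loop_low //; have [|->|->|[s ->]] := @arc_image alpha p q t.
    - by lra.
    - by left; left.
    - by left; right.
    - by right; left; exists s.
  rewrite loop_high //; have [|->|->|[s ->]] := @arc_image beta p q (1 - t).
  - by lra.
  - by left; left.
  - by left; right.
  - by right; right; exists s.
move=> [[->|->]|[[s _ <-]|[s _ <-]]].
- exists 0; first by rewrite /= in_itv /= lexx ler01.
  by rewrite loop_low ?arc0 // divr_ge0.
- exists (1 / 2); first by rewrite /= in_itv /=; lra.
  by rewrite loop_low ?arc_half.
- have s0 := line_to_unit_itv s.
  exists (line_to_unit s); first by rewrite /= in_itv /=; lra.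
  rewrite loop_low; last by lra.
  by rewrite arc_in // line_to_unitK.
- have s0 := line_to_unit_itv s.
  exists (1 - line_to_unit s); first by rewrite /= in_itv /=; lra.
  rewrite loop_high; last by lra.
  by rewrite subKr arc_in // line_to_unitK.
Qed.

Lemma loop_anti alpha beta p q (d : V -> R) : d p <= d q ->
  (forall s, d p <= d (beta s) <= d q) ->
  (forall s s', s <= s' -> d (beta s') <= d (beta s)) ->
  forall t t', 1 / 2 <= t -> t <= t' -> t' <= 1 ->
  d (loop alpha beta p q t') <= d (loop alpha beta p q t).
Proof.
move=> dpq dlim danti t t' t1 tt' t'1.
rewrite !loop_high //; last exact: le_trans tt'.
have range u : d p <= d (arc beta p q u) <= d q.
  rewrite /arc; case: (leP u 0) => _; first by rewrite lexx.
  by case: (leP (1 / 2) u) => _; [rewrite lexx dpq|exact: dlim].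
have [t'_1|t'_1] := leP 1 t'.
  by rewrite {1}/arc subr_le0 t'_1; case/andP: (range (1 - t)).
have [t_1|t_1] := leP t (1 / 2).
  rewrite {2}/arc (_ : 1 - t <= 0 = false); last by apply/negbTE;
    rewrite -ltNge; lra.
  rewrite (_ : 1 / 2 <= 1 - t); last by lra.
  by case/andP: (range (1 - t')).
rewrite !arc_in; try lra.
by apply: danti; apply: unit_to_line_le; lra.
Qed.

End Arc.
End JordanArms.

(** * Polar coordinates *)

Section Polar.
Variable R : realType.
Implicit Types (a b h u v th : R).

(* Consecutive unit intervals of [u] are mapped to annuli whose moduli tend to
   infinity at both ends. *)
Definition radial u : R := expR (2 * u + u * `|u|).

Lemma radial_gt0 u : 0 < radial u.
Proof. exact: expR_gt0. Qed.

Lemma radial_exponent_expanding u v : u <= v ->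
  2 * (v - u) <= (2 * v + v * `|v|) - (2 * u + u * `|u|).
Proof.
move=> uv; suff : u * `|u| <= v * `|v| by lra.
case: (leP 0 u) => u0; case: (leP 0 v) => v0;
  rewrite ?(ger0_norm u0) ?(ltr0_norm u0) ?(ger0_norm v0) ?(ltr0_norm v0); nra.
Qed.

Lemma ltr_radial : {mono radial : u v / u < v}.
Proof.
move=> u v; rewrite /radial ltr_expR; case: (ltP u v) => uv.
  by have := radial_exponent_expanding (ltW uv); lra.
by apply/negbTE; rewrite -leNgt; have := radial_exponent_expanding uv; lra.
Qed.

Lemma radial_inj : injective radial.
Proof.
move=> u v uv; case: (ltgtP u v) => //; rewrite -ltr_radial uv ltxx //.
Qed.

Lemma radial_le u v : u <= v -> radial u <= radial v.
Proof. by rewrite !leNgt ltr_radial. Qed.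

Lemma radial_ratio u v c :
  c <= (2 * v + v * `|v|) - (2 * u + u * `|u|) ->
  (1 + c) * radial u <= radial v.
Proof.
move=> cuv; rewrite [radial v](_ : _ = expR ((2 * v + v * `|v|) -
  (2 * u + u * `|u|)) * radial u); last by rewrite /radial -expRD subrK.
rewrite ler_pM2r ?radial_gt0 //; apply: le_trans (expR_ge1Dx _).
by rewrite lerD2l.
Qed.

(** The linear term of the exponent already gives the factor [1 + 2]. This is the room that
    [quadrant_disc] has within one unit of [u], whatever the modulus. *)
Lemma radial_step u : 3 * radial u <= radial (u + 1).
Proof.
rewrite (_ : 3 = 1 + 2); last by ring.
apply: radial_ratio; have := @radial_exponent_expanding u (u + 1).
by rewrite lerDl ler01 => /(_ isT); lra.
Qed.

Lemma radial_surj a : 0 < a -> exists u, radial u = a.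
Proof.
move=> a0; pose m := Num.sqrt (1 + `|ln a|).
have m1 : 1 <= m by rewrite -[leLHS]sqrtr1 ler_wsqrtr // lerDl.
have m2 : m ^+ 2 = 1 + `|ln a| by rewrite sqr_sqrtr // addr_ge0.
have n0 : 0 < 1 + m by lra.
exists (ln a / (1 + m)); rewrite /radial normrM normfV (gtr0_norm n0).
rewrite (_ : `|ln a| = (m - 1) * (1 + m)); last by lra.
rewrite (_ : _ + _ = ln a) ?lnK //.
by field; rewrite gt_eqF.
Qed.

Lemma continuous_radial : continuous radial.
Proof.
move=> u; apply: (@continuous_comp _ _ _ (fun u : R => 2 * u + u * `|u|)).
  apply: cvgD; apply: cvgM; try exact: cvg_cst; try exact: cvg_id.
  by apply: cvg_norm; exact: cvg_id.
exact: continuous_expR.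
Qed.

Lemma radial_ge u : 0 <= u -> 1 + u <= radial u.
Proof.
move=> u0; apply: le_trans (expR_ge1Dx _); rewrite lerD2l ger0_norm //.
by nra.
Qed.

Lemma radial_neg u : radial (- u) = (radial u)^-1.
Proof. by rewrite /radial normrN mulrN mulNr -opprD expRN. Qed.

(* [(abscissa th, ordinate th)], [-2 <= th <= 2], is the unit circle of the
   norm [|a| + |b|]. *)
Definition abscissa th : R := 1 - `|th|.
Definition ordinate th : R := Num.max (Num.min th (2 - th)) (- 2 - th).

Lemma ordinate_mid th : `|th| <= 1 -> ordinate th = th.
Proof.
rewrite ler_norml => th1; rewrite /ordinate min_l; last by lra.
by rewrite max_l //; lra.
Qed.

Lemma ordinate_high th : 1 <= th -> ordinate th = 2 - th.
Proof.
move=> th1; rewrite /ordinate min_r; last by lra.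
by rewrite max_l //; lra.
Qed.

Lemma ordinate_low th : th <= -1 -> ordinate th = - 2 - th.
Proof.
move=> th1; rewrite /ordinate min_l; last by lra.
by rewrite max_r //; lra.
Qed.

Lemma circle_cases th : -2 <= th <= 2 ->
  [\/ [/\ -1 <= th, th <= 1 & ordinate th = th],
      [/\ 1 <= th, abscissa th = 1 - th & ordinate th = 2 - th] |
      [/\ th <= -1, abscissa th = 1 + th & ordinate th = - 2 - th]].
Proof.
move=> th2; case: (leP th (-1)) => th_1.
  have n : `|th| = - th by rewrite ler0_norm //; lra.
  by constructor 3; rewrite ordinate_low // /abscissa n; split; lra.
case: (leP 1 th) => th1.
  have n : `|th| = th by rewrite ger0_norm //; lra.
  by constructor 2; rewrite ordinate_high // /abscissa n; split; lra.
constructor 1; rewrite ordinate_mid; first by split; lra.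
by rewrite ler_norml; lra.
Qed.

Lemma circle_norm th : -2 <= th <= 2 -> `|abscissa th| + `|ordinate th| = 1.
Proof.
move=> th2; case: (circle_cases th2) => [[t1 t2 ->]|[t1 -> ->]|[t1 -> ->]].
- by rewrite /abscissa ger0_norm ?subrK // subr_ge0 ler_norml t1.
- by rewrite ler0_norm ?ger0_norm; lra.
- by rewrite !ler0_norm; lra.
Qed.

Lemma circle_inj th th' : -2 < th <= 2 -> -2 < th' <= 2 ->
  abscissa th = abscissa th' -> ordinate th = ordinate th' -> th = th'.
Proof.
move=> h h'; have := @circle_cases th; have := @circle_cases th'.
move=> /(_ ltac:(lra)) c' /(_ ltac:(lra)) c e.
have : `|th| = `|th'| by move: e; rewrite /abscissa; lra.
move/eqP; rewrite eqr_norm2 => /orP[/eqP //|/eqP e'].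
case: c => [[? ? ->]|[? _ ->]|[? _ ->]]; case: c' =>
  [[? ? ->]|[? _ ->]|[? _ ->]];
  lra.
Qed.

Lemma continuous_abscissa : continuous abscissa.
Proof.
move=> t; apply: cvgB; first exact: cvg_cst.
by apply: cvg_norm; exact: cvg_id.
Qed.

Lemma continuous_ordinate : continuous ordinate.
Proof.
have cB (c : R) : continuous (fun t : R => c - t).
  by move=> t; apply: cvgB; [exact: cvg_cst|exact: cvg_id].
move=> t; apply: (@continuous_max R R (fun t : R => Num.min t (2 - t))
  (fun t : R => - 2 - t)); last exact: cB.
apply: (@continuous_min R R id (fun t : R => 2 - t)); last exact: cB.
exact: cvg_id.
Qed.

(** Polar coordinates for the norm [|a| + |b|]: directions are piecewise linear in [th], which keeps
    the search for discs within linear arithmetic. The values [th = 2] and [th = -2] both give the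
    negative real axis. *)
Definition polar u th : 'rV[R]_3 :=
  stereo (radial u * abscissa th) (radial u * ordinate th).

Lemma stereo_inj a b a' b' : stereo a b = stereo a' b' -> a = a' /\ b = b'.
Proof.
move=> e; have := dot_chart a b 0 a' b' 0.
rewrite -/(stereo a b) -/(stereo a' b') e [dot _ _]stereo_CP1 subrr =>
  /esym/eqP.
rewrite !expr0n /= !addr0 !mulf_eq0 invr_eq0 mulf_eq0 pnatr_eq0 /=.
have := chart_den_gt0 a b 0; have := chart_den_gt0 a' b' 0.
rewrite !expr0n /= !addr0 => S0 S1.
rewrite (gt_eqF S0) (gt_eqF S1) !orbF => /eqP ab0.
have sa := sqr_ge0 (a - a'); have sb := sqr_ge0 (b - b').
have /eqP : (a - a') ^+ 2 = 0 by lra.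
rewrite sqrf_eq0 subr_eq0 => /eqP ->.
have /eqP : (b - b') ^+ 2 = 0 by lra.
by rewrite sqrf_eq0 subr_eq0 => /eqP ->.
Qed.

Lemma stereo_north a b : stereo a b <> north R.
Proof.
move=> e; have := dot_chart_north a b 0.
rewrite -/(stereo a b) e dot_north_north subrr => /esym/eqP.
by rewrite mulf_eq0 invr_eq0 pnatr_eq0 /= gt_eqF ?chart_den_gt0.
Qed.

Lemma polar_norm u th : -2 <= th <= 2 ->
  `|radial u * abscissa th| + `|radial u * ordinate th| = radial u.
Proof.
by move=> th2; rewrite !normrM -mulrDr circle_norm // mulr1 gtr0_norm
  ?radial_gt0.
Qed.

Lemma polar_inj u th u' th' : -2 < th <= 2 -> -2 < th' <= 2 ->
  polar u th = polar u' th' -> u = u' /\ th = th'.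
Proof.
move=> h h' /stereo_inj[ea eb].
have uu' : u = u'.
  apply: radial_inj; rewrite -(@polar_norm u th); last by lra.
  by rewrite ea eb polar_norm //; lra.
split=> //; rewrite uu' in ea eb.
have r0 : radial u' != 0 by rewrite gt_eqF ?radial_gt0.
by apply: circle_inj => //; apply: (mulfI r0).
Qed.

Lemma polar_origin u th : -2 <= th <= 2 -> polar u th <> stereo 0 0.
Proof.
move=> h /stereo_inj[ea eb]; have := polar_norm u h; rewrite ea eb normr0 addr0.
by move=> e; have := radial_gt0 u; rewrite -e ltxx.
Qed.

Lemma polar_surj_right a b : 0 <= a -> 0 < a + `|b| ->
  exists u th, [/\ radial u = a + `|b|, th = b / (a + `|b|), -1 <= th <= 1
    & stereo a b = polar u th].
Proof.
move=> a0 n0; have [u ru] := radial_surj n0.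
exists u, (b / (a + `|b|)); have [lb ub] := (ler_norm b, ler_norm (- b)).
rewrite normrN in ub.
have th1 : -1 <= b / (a + `|b|) <= 1.
  by rewrite ler_pdivlMr // ler_pdivrMr //; lra.
split=> //; rewrite /polar ru /abscissa ordinate_mid ?ler_norml //.
rewrite normrM normfV (gtr0_norm n0).
by congr stereo; field; rewrite gt_eqF.
Qed.

(** The sign [e] tells the upper from the lower quadrant. They meet along the negative axis,
    [e * th = 2], which is excluded as soon as [0 < e * b]. *)
Lemma polar_surj_left a b (e : R) : e = 1 \/ e = -1 -> a < 0 -> 0 <= e * b ->
  exists u th, [/\ 1 < e * th <= 2, 0 < e * b -> e * th < 2
    & stereo a b = polar u th].
Proof.
move=> he a0 b0; have n0 : 0 < e * b - a by lra.
have [u ru] := radial_surj n0.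
have q1 : 0 <= e * b / (e * b - a) < 1.
  rewrite divr_ge0 ?(ltW n0) //= ltr_pdivrMr //; lra.
have q0 : 0 < e * b -> 0 < e * b / (e * b - a) by move=> h; rewrite divr_gt0.
have ee : e * e = 1 by case: he => ->; ring.
exists u, (e * (2 - e * b / (e * b - a))); rewrite mulrA ee mul1r.
split=> [|/q0 h|]; [lra|lra|].
have habs q : 0 <= q < 1 -> abscissa (e * (2 - q)) = - 1 + q.
  by case: he => -> hq; rewrite /abscissa ?mul1r ?mulN1r ?normrN ger0_norm; lra.
have hord q : 0 <= q < 1 -> ordinate (e * (2 - q)) = e * q.
  case: he => -> hq; rewrite ?mul1r ?mulN1r.
    by rewrite ordinate_high; lra.
  by rewrite ordinate_low; lra.
rewrite /polar ru habs // hord //.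
congr stereo; first by field; rewrite gt_eqF.
transitivity (e * e * b); first by rewrite ee mul1r.
by field; rewrite gt_eqF.
Qed.

Lemma continuous_polar (T : topologicalType) (U Th : T -> R) :
  continuous U -> continuous Th -> continuous (fun t => polar (U t) (Th t)).
Proof.
move=> cU cTh.
have stereo_cont (A B : T -> R) : continuous A -> continuous B ->
    continuous (fun t => stereo (A t) (B t)).
  move=> cA cB.
  have cS : continuous (fun t => A t ^+ 2 + B t ^+ 2 + 0 ^+ 2).
    move=> t; apply: cvgD; last exact: cvg_cst.
    by apply: cvgD; apply: cvgM; by [apply: cA|apply: cB].
  have cV : continuous (fun t => (A t ^+ 2 + B t ^+ 2 + 0 ^+ 2 + 1)^-1).
    move=> t; apply: cvgV; first by rewrite gt_eqF ?chart_den_gt0.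
    by apply: cvgD; [exact: cS|exact: cvg_cst].
  apply: continuous_row3.
  - rewrite (_ : (fun t => _) = (fun t =>
      (A t ^+ 2 + B t ^+ 2 + 0 ^+ 2 + 1)^-1 * (2 * A t))); last first.
      by apply/funext => t; rewrite /stereo /chart scale_rowE vec3E.
    by move=> t; apply: cvgM; [exact: cV|apply: cvgM;
      [exact: cvg_cst|exact: cA]].
  - rewrite (_ : (fun t => _) = (fun t =>
      (A t ^+ 2 + B t ^+ 2 + 0 ^+ 2 + 1)^-1 * (2 * B t))); last first.
      by apply/funext => t; rewrite /stereo /chart scale_rowE vec3E.
    by move=> t; apply: cvgM; [exact: cV|apply: cvgM;
      [exact: cvg_cst|exact: cB]].
  - rewrite (_ : (fun t => _) = (fun t =>
    (A t ^+ 2 + B t ^+ 2 + 0 ^+ 2 + 1)^-1 *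
      (A t ^+ 2 + B t ^+ 2 + 0 ^+ 2 - 1))); last first.
      by apply/funext => t; rewrite /stereo /chart scale_rowE vec3E.
    by move=> t; apply: cvgM; [exact: cV|apply: cvgB;
      [exact: cS|exact: cvg_cst]].
have crU : continuous (fun t => radial (U t)).
  by move=> t; apply: (@continuous_comp _ _ _ U);
    [exact: cU|exact: continuous_radial].
apply: stereo_cont => t; apply: cvgM; try exact: crU.
  by apply: (@continuous_comp _ _ _ Th);
    [exact: cTh|exact: continuous_abscissa].
by apply: (@continuous_comp _ _ _ Th); [exact: cTh|exact: continuous_ordinate].
Qed.

Lemma norm_lt_dot (x : 'rV[R]_3) e : 0 < e -> dot x x < e ^+ 2 -> `|x| < e.
Proof.
move=> e0 xe; rewrite -(@ltr_pXn2r _ 2) ?nnegrE ?(ltW e0) //.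
exact: le_lt_trans (norm_le_dot x) xe.
Qed.

Lemma polar_sq u th : -2 <= th <= 2 -> radial u ^+ 2 / 2 <=
  (radial u * abscissa th) ^+ 2 + (radial u * ordinate th) ^+ 2 <= radial u ^+
    2.
Proof.
move=> h; have := polar_norm u h.
rewrite -(real_normK (num_real (_ * abscissa _))).
rewrite -(real_normK (num_real (_ * ordinate _))).
set x := `|_ * abscissa _|; set y := `|_ * ordinate _| => <-.
have x0 : 0 <= x by exact: normr_ge0.
have y0 : 0 <= y by exact: normr_ge0.
have := sqr_ge0 (x - y); have := mulr_ge0 x0 y0; lra.
Qed.

Lemma polar_cvg_north (T : Type) (F : set_system T) (U Th : T ->
  R) : Filter F ->
  (forall t, -2 <= Th t <= 2) -> U @ F --> +oo ->
  (fun t => polar (U t) (Th t)) @ F --> north R.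
Proof.
move=> FF hTh cU; apply/cvgrPdist_lt => e e0.
have FU : \forall t \near F, 4 / e < U t.
  by apply: (cU [set x | 4 / e < x]); exists (4 / e); split; [exact: num_real|].
near=> t; apply: norm_lt_dot => //.
have Ut : 4 / e < U t by near: t.
have U0 : 0 < U t by apply: lt_trans Ut; rewrite divr_gt0.
have rU := radial_ge (ltW U0).
have /andP[rS _] := polar_sq (U t) (hTh t).
have := edist_north (radial (U t) * abscissa (Th t)) (radial (U t) * ordinate
  (Th t)).
rewrite -/(polar _ _) => /(congr1 (fun z => z ^+ 2)).
rewrite exprMn exprVn !sqr_sqrtr ?dot_ge0 //; last first.
  by rewrite !addr_ge0 ?sqr_ge0.
move=> ->; set S := _ + 1.
have S0 : U t ^+ 2 / 2 < S by rewrite /S; nra.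
have S00 : 0 < S by apply: lt_trans S0; rewrite divr_gt0 ?exprn_gt0.
rewrite ltr_pdivrMr //.
have : 4 < U t * e by rewrite -ltr_pdivrMr.
move=> Ue; have : 16 < (U t * e) ^+ 2 by nra.
rewrite exprMn => h; have := exprn_gt0 2 e0; nra.
Unshelve. all: by end_near. Qed.

Lemma polar_cvg_south (T : Type) (F : set_system T) (U Th : T ->
  R) : Filter F ->
  (forall t, -2 <= Th t <= 2) -> U @ F --> -oo ->
  (fun t => polar (U t) (Th t)) @ F --> stereo (0 : R) 0.
Proof.
move=> FF hTh cU; apply/cvgrPdist_lt => e e0.
have FU : \forall t \near F, U t < - (2 / e).
  by apply: (cU [set x | x < - (2 / e)]); exists (- (2 / e)); split;
    [exact: num_real|].
near=> t; apply: norm_lt_dot => //.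
have Ut : U t < - (2 / e) by near: t.
have U0 : U t < 0 by apply: lt_trans Ut _; rewrite oppr_lt0 divr_gt0.
have rU : radial (U t) < e / 2.
  rewrite -[U t]opprK radial_neg -[ltRHS]invrK invf_div ltf_pV2 ?posrE ?divr_gt0
    ?radial_gt0 //.
  by have := @radial_ge (- U t); rewrite oppr_ge0 (ltW U0) => /(_ isT); lra.
have /andP[_ rS] := polar_sq (U t) (hTh t).
have := dot_chart 0 0 0 (radial (U t) * abscissa (Th t)) (radial (U t) *
  ordinate (Th t)) 0.
rewrite -/(stereo _ _) -/(stereo _ _) -/(polar _ _).
have := stereo_CP1 (radial (U t) * abscissa (Th t)) (radial (U t) * ordinate
  (Th t)).
have := stereo_CP1 (0 : R) 0; rewrite /CP1 /= -/(polar _ _).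
rewrite !sub0r !sqrrN !expr0n /= !addr0 !add0r mul1r.
set P := polar _ _; set Q := stereo 0 0; set S := (_ * abscissa _) ^+ 2 + _ =>
  QQ PP QP.
clearbody P Q.
have -> : dot (Q - P) (Q - P) = 2 * (1 - dot Q P).
  by rewrite !dot_linE (dotC P Q) QQ PP; ring.
rewrite QP; have S0 : 0 <= S by rewrite /S addr_ge0 ?sqr_ge0.
apply: (@le_lt_trans _ _ (4 * S)).
  rewrite mulrA ler_pdivrMr; last by lra.
  by have := mulr_ge0 S0 S0; lra.
have r0 := radial_gt0 (U t).
have {}rS : S <= radial (U t) ^+ 2 by [].
clearbody S.
have : 0 < (e / 2 - radial (U t)) * (e / 2 + radial (U t)).
  by rewrite mulr_gt0 //; lra.
lra.
Unshelve. all: by end_near. Qed.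

End Polar.

(** * The zigzag *)

Section Zigzag.
Variable R : realType.
Implicit Types (a b c h u v th s : R) (k : int) (e : R).

Lemma int_eq k k' : k%:~R < k'%:~R + 1 :> R -> k'%:~R < k%:~R + 1 :> R ->
  k = k'.
Proof.
rewrite -[1]/(1%:~R) -!intrD !ltr_int !ltzD1 => h h'.
by apply/eqP; rewrite eq_le h.
Qed.

Lemma floor_div c s : 0 < c -> exists k, c * k%:~R <= s < c * (k%:~R + 1).
Proof.
move=> c0; exists (Num.floor (s / c)); have /andP[h1 h2] := floor_itv (s / c).
rewrite mulrC -ler_pdivlMr // h1 /= mulrC -ltr_pdivrMr //.
by rewrite intrD in h2.
Qed.

(** * Piecewise linear parametrization of one period *)

Definition clamp s : R := Num.max 0 (Num.min s 1).

Lemma clamp_le0 s : s <= 0 -> clamp s = 0.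
Proof. by move=> s0; rewrite /clamp min_l ?max_l //; lra. Qed.

Lemma clamp_ge1 s : 1 <= s -> clamp s = 1.
Proof. by move=> s1; rewrite /clamp min_r // max_r. Qed.

Lemma clamp_id s : 0 <= s <= 1 -> clamp s = s.
Proof. by case/andP=> s0 s1; rewrite /clamp min_l // max_r. Qed.

Lemma continuous_clamp : continuous clamp.
Proof.
move=> t; apply: (@continuous_max R R (fun=> 0) (fun s : R => Num.min s 1)).
  exact: cvg_cst.
by apply: (@continuous_min R R id (fun=> 1)); [exact: cvg_id|exact: cvg_cst].
Qed.

Lemma continuous_clampB c : continuous (fun s => clamp (s - c)).
Proof.
move=> t; apply: (@continuous_comp _ _ _ (fun s : R => s - c)); last first.
  exact: continuous_clamp.
by apply: cvgB; [exact: cvg_id|exact: cvg_cst].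
Qed.

(* [s |-> (zig_u s, zig_th s)], [0 <= s <= 6], runs through
   (0,1), (2,1), (2,0), (1,0), (1,-1), (3,-1), (3,1). *)
Definition zig_u s : R := 2 * clamp (s - 0) - clamp (s - 2) + 2 * clamp (s - 4).
Definition zig_th s : R :=
  1 - clamp (s - 1) - clamp (s - 3) + 2 * clamp (s - 5).

Lemma continuous_zig_u : continuous zig_u.
Proof.
move=> t; apply: cvgD; [apply: cvgB|]; try exact: continuous_clampB.
  by apply: cvgM; [exact: cvg_cst|exact: continuous_clampB].
by apply: cvgM; [exact: cvg_cst|exact: continuous_clampB].
Qed.

Lemma continuous_zig_th : continuous zig_th.
Proof.
move=> t; apply: cvgD; [apply: cvgB; [apply: cvgB|]|];
  try exact: continuous_clampB; first exact: cvg_cst.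
by apply: cvgM; [exact: cvg_cst|exact: continuous_clampB].
Qed.

Lemma zig_le0 s : s <= 0 -> zig_u s = 0 /\ zig_th s = 1.
Proof. by move=> s0; rewrite /zig_u /zig_th !clamp_le0; lra. Qed.

Lemma zig_ge6 s : 6 <= s -> zig_u s = 3 /\ zig_th s = 1.
Proof. by move=> s0; rewrite /zig_u /zig_th !clamp_ge1; lra. Qed.

Lemma zig1 s : 0 <= s -> s <= 1 -> zig_u s = 2 * s /\ zig_th s = 1.
Proof.
move=> s0 s1; rewrite /zig_u /zig_th (@clamp_id (s - 0)); last by lra.
by rewrite !clamp_le0; lra.
Qed.

Lemma zig2 s : 1 <= s -> s <= 2 -> zig_u s = 2 /\ zig_th s = 2 - s.
Proof.
move=> s0 s1; rewrite /zig_u /zig_th (@clamp_id (s - 1)); last by lra.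
by rewrite (@clamp_ge1 (s - 0)) ?clamp_le0; lra.
Qed.

Lemma zig3 s : 2 <= s -> s <= 3 -> zig_u s = 4 - s /\ zig_th s = 0.
Proof.
move=> s0 s1; rewrite /zig_u /zig_th (@clamp_id (s - 2)); last by lra.
rewrite (@clamp_ge1 (s - 0)); last by lra.
by rewrite (@clamp_ge1 (s - 1)) ?clamp_le0; lra.
Qed.

Lemma zig4 s : 3 <= s -> s <= 4 -> zig_u s = 1 /\ zig_th s = 3 - s.
Proof.
move=> s0 s1; rewrite /zig_u /zig_th (@clamp_id (s - 3)); last by lra.
rewrite (@clamp_ge1 (s - 0)); last by lra.
rewrite (@clamp_ge1 (s - 1)); last by lra.
by rewrite (@clamp_ge1 (s - 2)) ?clamp_le0; lra.
Qed.

Lemma zig5 s : 4 <= s -> s <= 5 -> zig_u s = 2 * s - 7 /\ zig_th s = -1.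
Proof.
move=> s0 s1; rewrite /zig_u /zig_th (@clamp_id (s - 4)); last by lra.
rewrite (@clamp_le0 (s - 5)); last by lra.
by rewrite !clamp_ge1; lra.
Qed.

Lemma zig6 s : 5 <= s -> s <= 6 -> zig_u s = 3 /\ zig_th s = 2 * s - 11.
Proof.
move=> s0 s1; rewrite /zig_u /zig_th (@clamp_id (s - 5)); last by lra.
by rewrite !clamp_ge1; lra.
Qed.

Variant zig_spec s : R -> R -> Prop :=
| Zig1 of 0 <= s & s <= 1 : zig_spec s (2 * s) 1
| Zig2 of 1 <= s & s <= 2 : zig_spec s 2 (2 - s)
| Zig3 of 2 <= s & s <= 3 : zig_spec s (4 - s) 0
| Zig4 of 3 <= s & s <= 4 : zig_spec s 1 (3 - s)
| Zig5 of 4 <= s & s <= 5 : zig_spec s (2 * s - 7) (-1)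
| Zig6 of 5 <= s & s <= 6 : zig_spec s 3 (2 * s - 11).

Lemma zigP s : 0 <= s <= 6 -> zig_spec s (zig_u s) (zig_th s).
Proof.
move=> /andP[s0 s6].
have [s1|/ltW s1] := leP s 1; first by have [-> ->] := zig1 s0 s1; exact: Zig1.
have [s2|/ltW s2] := leP s 2; first by have [-> ->] := zig2 s1 s2; exact: Zig2.
have [s3|/ltW s3] := leP s 3; first by have [-> ->] := zig3 s2 s3; exact: Zig3.
have [s4|/ltW s4] := leP s 4; first by have [-> ->] := zig4 s3 s4; exact: Zig4.
have [s5|/ltW s5] := leP s 5; first by have [-> ->] := zig5 s4 s5; exact: Zig5.
by have [-> ->] := zig6 s5 s6; exact: Zig6.
Qed.

Lemma zig_inj s s' : 0 <= s <= 6 -> 0 <= s' <= 6 ->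
  zig_u s = zig_u s' -> zig_th s = zig_th s' -> s = s'.
Proof. by move=> /zigP[] h1 h2 /zigP[] h3 h4 e1 e2; lra. Qed.

Lemma zig_u_range s : 0 <= s <= 6 -> 0 <= zig_u s <= 3.
Proof. by move=> /zigP[] h1 h2; lra. Qed.

Lemma zig_start s : 0 <= s <= 6 -> zig_u s = 0 -> zig_th s = 1.
Proof. by move=> /zigP[] h1 h2 e; lra. Qed.

Lemma zig_end s : 0 <= s <= 6 -> s < 6 -> zig_u s = 3 -> zig_th s < 1.
Proof. by move=> /zigP[] h1 h2 s6 e; lra. Qed.

(** The continuation of [f] from a period of length 6 that grows by [c] with each period. *)
Definition tile (f : R -> R) c s : R :=
  c * (Num.floor (s / 6))%:~R + f (s - 6 * (Num.floor (s / 6))%:~R).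

Lemma floor6 k s : 6 * k%:~R <= s < 6 * (k%:~R + 1) -> Num.floor (s / 6) = k.
Proof.
by move=> h; apply: floor_def; rewrite ler_pdivlMr // ltr_pdivrMr // intrD; lra.
Qed.

Lemma tileE (f : R -> R) c k s : f 6 = c + f 0 ->
  0 <= s <= 6 -> tile f c (6 * k%:~R + s) = c * k%:~R + f s.
Proof.
move=> f6 /andP[s0]; rewrite le_eqVlt => /orP[/eqP ->|s6]; rewrite /tile.
  rewrite (@floor6 (k + 1)) ?intrD; last by lra.
  rewrite (_ : 6 * k%:~R + 6 - 6 * (k%:~R + 1) = 0); last by ring.
  by rewrite f6; ring.
rewrite (@floor6 k); last by lra.
by rewrite (_ : 6 * k%:~R + s - 6 * k%:~R = s) //; ring.
Qed.

Lemma continuous_tile (f : R -> R) c d : continuous f ->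
  (forall s, s <= 0 -> f s = d) -> (forall s, 6 <= s -> f s = c + d) ->
  continuous (tile f c).
Proof.
move=> cf f0 f6 s.
have [k /andP[k1 k2]] := @floor_div 6 s ltac:(lra).
(* Around [s], which may be a junction, two consecutive periods are added: outside its own period
   each summand is constant, [c + d] on the right and [d] on the left, so [g] is [tile f c] on
   both. *)
pose g t := c * (k%:~R - 1) + f (t - 6 * (k%:~R - 1)) + f (t - 6 * k%:~R) - d.
have fg t : 6 * (k%:~R - 1) < t -> t < 6 * (k%:~R + 1) -> tile f c t = g t.
  move=> t1 t2; rewrite /tile /g; have [kt|tk] := leP (6 * k%:~R) t.
    by rewrite (@floor6 k) ?(f6 (t - 6 * (k%:~R - 1))); lra.
  rewrite (@floor6 (k - 1)) ?intrB; last by lra.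
  by rewrite (f0 (t - 6 * k%:~R)); lra.
have cg : {for s, continuous g}.
  have cfB b : {for s, continuous (fun t => f (t - b))}.
    apply: (@continuous_comp _ _ _ (fun t : R => t - b)); last exact: cf.
    by apply: cvgB; [exact: cvg_id|exact: cvg_cst].
  apply: cvgB; last exact: cvg_cst.
  apply: cvgD; last exact: cfB.
  by apply: cvgD; [exact: cvg_cst|exact: cfB].
rewrite /continuous_at fg; try lra.
move: cg; rewrite /prop_for /continuous_at; apply: cvg_trans.
apply: near_eq_cvg; near=> t.
rewrite fg //; near: t; [apply: lt_nbhsr|apply: lt_nbhsl]; lra.
Unshelve. all: by end_near. Qed.

Definition arm_u : R -> R := tile zig_u 3.
Definition arm_th : R -> R := tile zig_th 0.

Lemma continuous_arm_u : continuous arm_u.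
Proof.
apply: (@continuous_tile _ _ 0); first exact: continuous_zig_u.
  by move=> s /zig_le0[].
by move=> s /zig_ge6[-> _]; rewrite addr0.
Qed.

Lemma continuous_arm_th : continuous arm_th.
Proof.
apply: (@continuous_tile _ _ 1); first exact: continuous_zig_th.
  by move=> s /zig_le0[].
by move=> s /zig_ge6[_ ->]; rewrite add0r.
Qed.

Lemma arm_at k s : 0 <= s <= 6 ->
  arm_u (6 * k%:~R + s) = 3 * k%:~R + zig_u s /\
  arm_th (6 * k%:~R + s) = zig_th s.
Proof.
have [u0 th0] := @zig_le0 0 (lexx _); have [u6 th6] := @zig_ge6 6 (lexx _).
move=> h; rewrite /arm_u /arm_th !tileE //; first by rewrite mul0r add0r.
  by rewrite th0 th6 add0r.
by rewrite u0 u6 addr0.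
Qed.

Lemma arm_decomp s : exists k t, [/\ 0 <= t < 6, s = 6 * k%:~R + t,
  arm_u s = 3 * k%:~R + zig_u t & arm_th s = zig_th t].
Proof.
have [k k12] := @floor_div 6 s ltac:(lra).
exists k, (s - 6 * k%:~R); have e : s = 6 * k%:~R + (s - 6 * k%:~R) by lra.
have [|eu eth] := @arm_at k (s - 6 * k%:~R); first by lra.
by rewrite -e in eu eth; split; lra.
Qed.

Lemma arm_inj s s' : arm_u s = arm_u s' -> arm_th s = arm_th s' -> s = s'.
Proof.
have [k [t [t0 -> -> ->]]] := arm_decomp s.
have [k' [t' [t'0 -> -> ->]]] := arm_decomp s'.
have t6 : 0 <= t <= 6 by lra.
have t'6 : 0 <= t' <= 6 by lra.
have r := zig_u_range t6; have r' := zig_u_range t'6 => eu eth.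
(* Points of different blocks could coincide only on a junction line, with [zig_u] equal to 3 in one
   and 0 in the other. There the later block has [zig_th = 1], a value that the earlier one reaches
   only at the excluded parameter 6. *)
have kk' : k = k'.
  apply: int_eq; rewrite ltNge; apply/negP => le_k.
    have := @zig_end t' t'6; have := @zig_start t t6; rewrite eth.
    by move=> -> => [/(_ ltac:(lra) ltac:(lra))|]; lra.
  have := @zig_end t t6; have := @zig_start t' t'6; rewrite -eth.
  by move=> -> => [/(_ ltac:(lra) ltac:(lra))|]; lra.
move: eu; rewrite kk' => /addrI eu; congr (_ + _).
exact: zig_inj eu eth.
Qed.

(** * The arm and its two sides in the coordinates (u, th) *)

Definition zigzag v th : Prop :=
  [\/ [/\ 0 <= v, v <= 2 & th = 1], [/\ v = 2, 0 <= th & th <= 1],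
      [/\ 1 <= v, v <= 2 & th = 0] |
   [\/ [/\ v = 1, -1 <= th & th <= 0], [/\ 1 <= v, v <= 3 & th = -1] |
       [/\ v = 3, -1 <= th & th <= 1]]].

Lemma zigzag_zig s : 0 <= s <= 6 -> zigzag (zig_u s) (zig_th s).
Proof.
move=> /zigP[] h1 h2.
- by constructor 1; split; lra.
- by constructor 2; split; lra.
- by constructor 3; split; lra.
- by constructor 4; constructor 1; split; lra.
- by constructor 4; constructor 2; split; lra.
- by constructor 4; constructor 3; split; lra.
Qed.

Lemma zig_surj v th : zigzag v th ->
  exists s, [/\ 0 <= s <= 6, zig_u s = v & zig_th s = th].
Proof.
move=> [[h1 h2 h3]|[h1 h2 h3]|[h1 h2 h3]|
  [[h1 h2 h3]|[h1 h2 h3]|[h1 h2 h3]]].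
- exists (v / 2); have [||-> ->] := @zig1 (v / 2); try split; lra.
- exists (2 - th); have [||-> ->] := @zig2 (2 - th); try split; lra.
- exists (4 - v); have [||-> ->] := @zig3 (4 - v); try split; lra.
- exists (3 - th); have [||-> ->] := @zig4 (3 - th); try split; lra.
- exists ((v + 7) / 2); have [||-> ->] := @zig5 ((v + 7) / 2); try split; lra.
- exists ((th + 11) / 2); have [||-> ->] := @zig6 ((th + 11) / 2); try split;
  lra.
Qed.

Definition on_arm u th : Prop := exists k, zigzag (u - 3 * k%:~R) th.

Lemma on_armP u th : on_arm u th <-> exists s, u = arm_u s /\ th = arm_th s.
Proof.
split=> [[k /zig_surj[s [s0 eu eth]]]|[s [-> ->]]].
  exists (6 * k%:~R + s); have [-> ->] := arm_at k s0.
  by rewrite eu eth; split=> //; lra.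
have [k [t [t0 _ -> ->]]] := arm_decomp s; exists k.
by rewrite addrAC subrr add0r; apply: zigzag_zig; lra.
Qed.

Lemma on_arm_range u th : on_arm u th -> -1 <= th <= 1.
Proof.
by move=> [k [[h1 h2 h3]|[h1 h2 h3]|[h1 h2 h3]|
  [[h1 h2 h3]|[h1 h2 h3]|[h1 h2 h3]]]]; lra.
Qed.

(* A block is invariant under the half-turn about [(3/2, 0)], except that its
   end is moved to its beginning. *)
Lemma on_armN u th : on_arm u th -> on_arm (- u) (- th).
Proof.
move=> [k [[h1 h2 h3]|[h1 h2 h3]|[h1 h2 h3]|
  [[h1 h2 h3]|[h1 h2 h3]|[h1 h2 h3]]]].
- exists (- k - 1); rewrite intrB intrN; constructor 4; constructor 2; split;
  lra.
- exists (- k - 1); rewrite intrB intrN; constructor 4; constructor 1; split;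
  lra.
- exists (- k - 1); rewrite intrB intrN; constructor 3; split; lra.
- exists (- k - 1); rewrite intrB intrN; constructor 2; split; lra.
- exists (- k - 1); rewrite intrB intrN; constructor 1; split; lra.
- exists (- k - 2); rewrite intrB intrN; constructor 4; constructor 3; split;
  lra.
Qed.

(* [plus_side] is one side of the curve in the coordinates [(u, th)]; the other
   one is its image under [(u, th) |-> (- u, - th)]. *)
Definition plus_block v th : Prop :=
  (2 < v < 3 /\ -1 < th <= 1) \/ (1 < v < 3 /\ -1 < th < 0).

Definition plus_side u th : Prop :=
  1 < th < 2 \/ exists k, plus_block (u - 3 * k%:~R) th.

Lemma plus_side_range u th : plus_side u th -> -1 < th < 2.
Proof. by move=> [h|[k [[h1 h2]|[h1 h2]]]]; lra. Qed.

Lemma plus_side_arm u th : plus_side u th -> ~ on_arm u th.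
Proof.
move=> [h1 /on_arm_range|[k hk] [k' hk']]; first by lra.
have v3 : 1 < u - 3 * k%:~R < 3 by case: hk => -[]; lra.
have v'3 : 0 <= u - 3 * k'%:~R <= 3.
  by case: hk' => [[]|[]|[]|[[]|[]|[]]]; lra.
have e : k = k' by apply: int_eq; lra.
rewrite -e in hk'; case: hk => -[h1 h2];
  by case: hk' => [[]|[]|[]|[[]|[]|[]]]; lra.
Qed.

(* Near a point of the arm the plus side contains a corner: [o] and [sg] are the
   directions in which [u] and [th] leave the point and the axis [th = 0]. *)
Lemma plus_side_corner u th : on_arm u th -> th = 1 \/
  exists sg o, [/\ sg = 1 \/ sg = -1, o = 1 \/ o = -1, 0 <= sg * th <= 1 &
    forall u2 th2, 0 < o * (u2 - u) < 1 -> 0 < sg * th2 < 1 ->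
      plus_side u2 th2].
Proof.
have p1 : (1 : R) = 1 \/ (1 : R) = -1 by left.
have n1 : (-1 : R) = 1 \/ (-1 : R) = -1 by right.
move=> [k [[h1 h2 h3]|[h1 h2 h3]|[h1 h2 h3]|
  [[h1 h2 h3]|[h1 h2 h3]|[h1 h2 h3]]]]; first by left.
- right; exists 1, 1; split=> //; first by lra.
  by move=> u2 t2 hu ht; right; exists k; left; lra.
- right; exists (-1), 1; split=> //; first by lra.
  by move=> u2 t2 hu ht; right; exists k; right; lra.
- right; exists (-1), 1; split=> //; first by lra.
  by move=> u2 t2 hu ht; right; exists k; right; lra.
- have [v2|v2] := leP (u - 3 * k%:~R) 2.
    right; exists (-1), 1; split=> //; first by lra.
    by move=> u2 t2 hu ht; right; exists k; right; lra.
  right; exists (-1), (-1); split=> //; first by lra.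
  by move=> u2 t2 hu ht; right; exists k; right; lra.
- have [v2|v2] := leP th 0.
    right; exists (-1), (-1); split=> //; first by lra.
    by move=> u2 t2 hu ht; right; exists k; right; lra.
  right; exists 1, (-1); split=> //; first by lra.
  by move=> u2 t2 hu ht; right; exists k; left; lra.
Qed.

(** The last two cases are exchanged by the half-turn of the block. The line [v = 0] is the closing
    segment [v = 3] of the previous block, hence its separate case. *)
Lemma block_cover v th : 0 <= v < 3 -> -1 <= th <= 1 ->
  [\/ zigzag v th, v = 0, plus_block v th | plus_block (3 - v) (- th)].
Proof.
case/andP=> v0 v3 /andP[th_1 th1].
have [th1'|th1'|->] := ltgtP th 1; last 2 first.
- by exfalso; lra.
- have [v2|v2] := leP v 2; first by constructor 1; constructor 1; split.
  by constructor 3; left; lra.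
have [th_1'|th_1'|->] := ltgtP th (-1); first by exfalso; lra.
- have [v1|v1|->] := ltgtP v 1.
  + have [v_0|v_0|->] := ltgtP v 0; first by exfalso; lra.
      by constructor 4; left; lra.
    by constructor 2.
  + have [v2|v2|->] := ltgtP v 2.
    * have [t0|t0|->] := ltgtP th 0.
      - by constructor 3; right; lra.
      - by constructor 4; right; lra.
      - by constructor 1; constructor 3; split; lra.
    * by constructor 3; left; lra.
    * have [t0|t0] := leP 0 th; first by constructor 1; constructor 2; split.
      by constructor 3; right; lra.
  + have [t0|t0] := leP th 0.
      by constructor 1; constructor 4; constructor 1; split.
    by constructor 4; right; lra.
- have [v1|v1] := ltP v 1.
    have [v_0|v_0|->] := ltgtP v 0; first by exfalso; lra.
      by constructor 4; left; lra.
    by constructor 2.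
  by constructor 1; constructor 4; constructor 2; split; lra.
Qed.

(** With [side_component], this leaves at most two components in the complement of the curve, one
    for each sign. *)
Lemma sides_cover u th : -2 < th < 2 -> ~ on_arm u th ->
  plus_side u th \/ plus_side (- u) (- th).
Proof.
move=> th2 narm.
have [th1|th1] := ltP 1 th; first by left; left; lra.
have [th_1|th_1] := ltP th (-1); first by right; left; lra.
have [k k12] := @floor_div 3 u ltac:(lra).
have h1 : 0 <= u - 3 * k%:~R < 3 by lra.
have h2 : -1 <= th <= 1 by rewrite th_1.
case: (block_cover h1 h2) => [hz|v0|hp|hm].
- by case: narm; exists k.
- case: narm; exists (k - 1); rewrite intrB.
  by constructor 4; constructor 3; split; lra.
- by left; right; exists k.
- right; right; exists (- k - 1); rewrite intrB intrN.
  by rewrite (_ : _ - _ = 3 - (u - 3 * k%:~R)) //; ring.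
Qed.

End Zigzag.

(** * The curve *)

Section Curve.
Variable R : realType.
Implicit Types (a b h u v th e : R) (k : int).

Local Notation south := (stereo (0 : R) 0).

Definition arm1 (s : R) : 'rV[R]_3 := polar (arm_u s) (arm_th s).
(** The negative real axis. *)
Definition arm2 (s : R) : 'rV[R]_3 := polar s 2.

Definition zigzag_loop : R -> 'rV[R]_3 := loop arm1 arm2 (north R) south.
Definition zigzag_curve : set 'rV[R]_3 := zigzag_loop @` `[0, 1].

Lemma arm_th_range (s : R) : -1 <= arm_th s <= 1.
Proof. by apply: (@on_arm_range _ (arm_u s)); apply/on_armP; exists s. Qed.

Lemma arm_u_bounds (s : R) : s / 2 - 3 <= arm_u s <= s / 2 + 3.
Proof.
have [k [t [t0 es -> _]]] := arm_decomp s.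
by have := @zig_u_range _ t ltac:(lra); lra.
Qed.

Lemma arm_u_cvgy : @arm_u R @ +oo --> (+oo : set_system R).
Proof.
move=> P [M [_ MP]]; exists (2 * M + 6); split; first exact: num_real.
by move=> s sM; apply: MP; have := arm_u_bounds s; lra.
Qed.

Lemma arm_u_cvgNy : @arm_u R @ -oo --> (-oo : set_system R).
Proof.
move=> P [M [_ MP]]; exists (2 * M - 6); split; first exact: num_real.
by move=> s sM; apply: MP; have := arm_u_bounds s; lra.
Qed.

Lemma continuous_zigzag_loop : continuous zigzag_loop.
Proof.
have th1 (s : R) : -2 <= arm_th s <= 2 by have := arm_th_range s; lra.
apply: continuous_loop.
- by apply: continuous_polar;
  [exact: continuous_arm_u|exact: continuous_arm_th].
- by apply: continuous_polar; [move=> s; exact: cvg_id|exact: cst_continuous].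
- by apply: polar_cvg_north => //; exact: arm_u_cvgy.
- by apply: polar_cvg_south => //; exact: arm_u_cvgNy.
- by apply: polar_cvg_north => [s|]; [lra|exact: cvg_id].
- by apply: polar_cvg_south => [s|]; [lra|exact: cvg_id].
Qed.

Lemma zigzag_loop0 : zigzag_loop 0 = north R.
Proof. by rewrite /zigzag_loop loop_low ?arc0 // divr_ge0. Qed.

Lemma zigzag_loop1 : zigzag_loop 1 = north R.
Proof. by rewrite /zigzag_loop loop_high ?subrr ?arc0 //; lra. Qed.

Lemma zigzag_loop_inj : {in `[0, 1[ &, injective zigzag_loop}.
Proof.
have th1 (s : R) : -2 < arm_th s <= 2 by have := arm_th_range s; lra.
have h2 : -2 < (2 : R) <= 2 by lra.
apply: loop_uniq.
- by move=> s s' /(polar_inj (th1 s) (th1 s'))[eu eth]; exact: arm_inj.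
- by move=> s s' /(polar_inj h2 h2)[].
- exact/nesym/stereo_north.
- move=> s; split; try exact: stereo_north.
    by apply: polar_origin; have := arm_th_range s; lra.
  by apply: polar_origin; lra.
- move=> s s' /(polar_inj (th1 s) h2)[_ e].
  by have := arm_th_range s; rewrite e; lra.
Qed.

Lemma zigzag_curveE : zigzag_curve =
  [set north R; south] `|` (range arm1 `|` range arm2).
Proof. exact: loop_image. Qed.

Lemma zigzag_curve_CP1 : zigzag_curve `<=` CP1 R.
Proof.
rewrite zigzag_curveE => _ [[->|->]|[[s _ <-]|[s _ <-]]];
  try exact: stereo_CP1.
exact: dot_north_north.
Qed.

Lemma jordan_zigzag_curve : jordan_curve zigzag_curve.
Proof.
exists zigzag_loop; split.
- by apply: continuous_subspaceT; exact: continuous_zigzag_loop.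
- by rewrite zigzag_loop0 zigzag_loop1.
- exact: zigzag_loop_inj.
- by [].
- exact: zigzag_curve_CP1.
Qed.

Lemma zigzag_curve_polar u th : -2 < th <= 2 ->
  zigzag_curve (polar u th) -> on_arm u th \/ th = 2.
Proof.
move=> h; rewrite zigzag_curveE => -[[e|e]|[[s _ e]|[s _ e]]].
- by case: (stereo_north e).
- by case: (@polar_origin _ u th _ e); lra.
- have h1 : -2 < arm_th s <= 2 by have := arm_th_range s; lra.
  have [<- <-] := polar_inj h1 h e.
  by left; apply/on_armP; exists s.
- have h2 : -2 < (2 : R) <= 2 by lra.
  by have [_ <-] := polar_inj h2 h e; right.
Qed.

Lemma zigzag_curve_stereo a b : zigzag_curve (stereo a b) ->
  (a = 0 /\ b = 0) \/ exists u th, [/\ a = radial u * abscissa th,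
    b = radial u * ordinate th & on_arm u th \/ th = 2].
Proof.
rewrite zigzag_curveE => -[[e|e]|[[s _ e]|[s _ e]]].
- by case: (stereo_north e).
- by left; apply: stereo_inj.
- right; exists (arm_u s), (arm_th s); have [-> ->] := stereo_inj e.
  by split=> //; left; apply/on_armP; exists s.
- by right; exists s, 2; have [-> ->] := stereo_inj e; split=> //; right.
Qed.

(** * The two sides of the curve *)

Lemma side_range e u th : e = 1 \/ e = -1 -> plus_side (e * u) (e * th) ->
  -2 < th < 2.
Proof. by move=> [->|->] /plus_side_range; lra. Qed.

Lemma side_zigzag_curve e u th : e = 1 \/ e = -1 ->
  plus_side (e * u) (e * th) -> ~ zigzag_curve (polar u th).
Proof.
move=> he hs; have h := side_range he hs.
move=> /(@zigzag_curve_polar u th ltac:(lra))[arm|]; last by lra.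
apply: (plus_side_arm hs); case: he => ->; first by rewrite !mul1r.
by rewrite !mulN1r; exact: on_armN.
Qed.

Lemma side_path e u th u' th' : e = 1 \/ e = -1 ->
  (forall t, 0 <= t <= 1 ->
    plus_side ((1 - t) * u + t * u') ((1 - t) * th + t * th')) ->
  connected_component (CP1 R `\` zigzag_curve)
    (polar (e * u) (e * th)) (polar (e * u') (e * th')).
Proof.
move=> he hs; have ee x : e * (e * x) = x by case: he => ->; ring.
have := @path_component _ _ (CP1 R `\` zigzag_curve)
  (fun t => polar (e * ((1 - t) * u + t * u')) (e * ((1 - t) * th + t * th'))).
rewrite subr0 subrr !mul0r !mul1r !addr0 !add0r; apply.
  have affine (x y : R) : continuous (fun t : R => e * ((1 - t) * x + t * y)).
    move=> t; apply: cvgM; first exact: cvg_cst.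
    apply: cvgD; apply: cvgM; try exact: cvg_cst; last exact: cvg_id.
    by apply: cvgB; [exact: cvg_cst|exact: cvg_id].
  exact: continuous_polar.
move=> t t01; split; first exact: stereo_CP1.
by apply: (side_zigzag_curve he); rewrite !ee; exact: hs.
Qed.

(** The lower part of a pocket is left by moving in [u] to its gate [2 < v < 3]; from there [th] can
    grow up to the strip [1 < th < 2], which is crossed in [u] to the base point. *)
Lemma side_component e u th : e = 1 \/ e = -1 ->
  plus_side (e * u) (e * th) ->
  connected_component (CP1 R `\` zigzag_curve)
    (polar u th) (polar (e * 0) (e * (3 / 2))).
Proof.
move=> he hs; have ee x : e * (e * x) = x by case: he => ->; ring.
rewrite -[u]ee -[th]ee; move: (e * u) (e * th) hs => {}u {}th hs.
have base v t : 1 < t < 2 -> connected_component (CP1 R `\` zigzag_curve)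
    (polar (e * v) (e * t)) (polar (e * 0) (e * (3 / 2))).
  by move=> t12; apply: side_path => // s s01; left; nra.
have gate v t k : 2 < v - 3 * k%:~R < 3 -> -1 < t <= 1 ->
    connected_component (CP1 R `\` zigzag_curve)
    (polar (e * v) (e * t)) (polar (e * 0) (e * (3 / 2))).
  move=> hv ht; apply: connected_component_trans (base v (3 / 2) _);
    last by lra.
  apply: side_path => // s s01; have -> : (1 - s) * v + s * v = v by ring.
  set x := _ + _; have x1 : -1 < x by rewrite /x; nra.
  have x2 : x < 2 by rewrite /x; nra.
  have [x3|x3] := leP x 1; last by left; lra.
  by right; exists k; left; lra.
case: hs => [h|[k [[h1 h2]|[h1 h2]]]]; first exact: base.
  exact: gate h1 h2.
apply: connected_component_trans (gate (3 * k%:~R + 5 / 2) th k _ _); try lra.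
apply: side_path => // s s01; right; exists k; right.
have -> : (1 - s) * th + s * th = th by ring.
by split=> //; nra.
Qed.

(** * Discs in the two sides *)

Lemma disc_box (x y h : R) : 0 < h -> x ^+ 2 + y ^+ 2 < h ^+ 2 ->
  - h < x < h /\ - h < y < h.
Proof.
move=> h0 xy; have x2 := sqr_ge0 x; have y2 := sqr_ge0 y.
by split; rewrite -ltr_norml -(@ltr_pXn2r _ 2) ?nnegrE ?(ltW h0) //
  real_normK ?num_real //; lra.
Qed.

(* A disc of radius [h] in the quadrant [sg * b > 0], [a > 0], just outside
   ([o = 1]) or just inside ([o = -1]) the circle of radius [radial u]. *)
Lemma quadrant_disc sg o u th h : sg = 1 \/ sg = -1 -> o = 1 \/ o = -1 ->
  0 <= sg * th <= 1 -> 0 < h -> 20 * h <= radial u ->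
  exists a' b', [/\ (a' - radial u * abscissa th) ^+ 2 +
      (b' - radial u * ordinate th) ^+ 2 <= 1000 * h ^+ 2 &
    forall a2 b2, (a2 - a') ^+ 2 + (b2 - b') ^+ 2 < h ^+ 2 -> exists u2 th2,
    [/\ stereo a2 b2 = polar u2 th2, 0 < o * (u2 - u) < 1 & 0 < sg * th2 < 1]].
Proof.
move=> hsg ho hth h0 hr; have r0 := radial_gt0 u.
have ss : sg * sg = 1 by case: hsg => ->; ring.
have nth : `|th| = sg * th.
  by case: hsg hth => ->; rewrite ?mul1r ?mulN1r => hth;
    [rewrite ger0_norm|rewrite ler0_norm]; lra.
have -> : ordinate th = sg * (sg * th).
  by rewrite mulrA ss mul1r ordinate_mid // nth; lra.
have -> : abscissa th = 1 - sg * th by rewrite /abscissa nth.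
set r := radial u in r0 hr *; set q := sg * th in hth *.
have hq1 : 0 <= r * q by apply: mulr_ge0; [exact: ltW|lra].
have hq2 : 0 <= r * (1 - q) by apply: mulr_ge0; [exact: ltW|lra].
have hr' : r * (1 - q) + r * q = r by ring.
have h2 := exprn_gt0 2 h0.
have disc x y lo hi : h < x -> h < y ->
    (forall x2 y2, x - h < x2 < x + h -> y - h < y2 < y + h ->
      lo < x2 + y2 < hi) ->
    (forall u2, lo < radial u2 < hi -> 0 < o * (u2 - u) < 1) ->
    forall a2 b2, (a2 - x) ^+ 2 + (b2 - sg * y) ^+ 2 < h ^+ 2 ->
    exists u2 th2, [/\ stereo a2 b2 = polar u2 th2, 0 < o * (u2 - u) < 1
      & 0 < sg * th2 < 1].
  move=> hx hy hxy hu a2 b2.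
  have -> : (b2 - sg * y) ^+ 2 = (sg * b2 - y) ^+ 2.
    transitivity ((sg * sg) * (b2 - sg * y) ^+ 2); first by rewrite ss mul1r.
    transitivity ((sg * b2 - sg * sg * y) ^+ 2); first by ring.
    by rewrite ss mul1r.
  move=> /(disc_box h0)[ha hb].
  have a20 : 0 < a2 by lra.
  have b20 : 0 < sg * b2 by lra.
  have nb : `|b2| = sg * b2.
    by case: hsg b20 => ->; rewrite ?mul1r ?mulN1r => hb2;
      [rewrite ger0_norm|rewrite ler0_norm]; lra.
  have [||u2 [th2 [ru2 eth2 _ est]]] := @polar_surj_right R a2 b2.
  - by lra.
  - by rewrite nb; lra.
  exists u2, th2; split=> //.
    by apply: hu; rewrite ru2 nb; apply: hxy; lra.
  rewrite eth2 nb mulrA; apply/andP; split; first by rewrite divr_gt0 //; lra.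
  by rewrite ltr_pdivrMr; lra.
case: ho => eo; rewrite eo in disc *.
  (* Moving both coordinates away from the axes by [2 * h] puts the norm [|a| + |b|] on the disc
     between [r + 2h] and [r + 6h]. *)
  exists (r * (1 - q) + 2 * h), (sg * (r * q + 2 * h)); split.
    have -> : (sg * (r * q + 2 * h) - r * (sg * q)) ^+ 2 =
      (sg * sg) * (2 * h) ^+ 2 by ring.
    by rewrite ss; nra.
  apply: (disc _ _ r (3 * r)); try lra.
    by move=> x2 y2 hx hy; lra.
  move=> u2 /andP[hu1 hu2]; have : u < u2 by rewrite -ltr_radial.
  have : u2 < u + 1 by rewrite -ltr_radial; exact: lt_le_trans (radial_step u).
  lra.
have inner : forall u2, r / 3 < radial u2 < r -> 0 < -1 * (u2 - u) < 1.
  move=> u2 /andP[hu1 hu2]; have : u2 < u by rewrite -ltr_radial.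
  have : u < u2 + 1.
    by rewrite -ltr_radial -/r; apply: lt_le_trans (radial_step u2); lra.
  lra.
(* The larger coordinate is at least [r / 2 >= 10 * h]. Lowering it by [6 * h] and raising the other
   one by [2 * h] keeps the disc in the quadrant, with norm between [r - 6h] and [r - 2h]. *)
have [qle|qlt] := leP (r * q) (r * (1 - q)).
  exists (r * (1 - q) - 6 * h), (sg * (r * q + 2 * h)); split.
    have -> : (sg * (r * q + 2 * h) - r * (sg * q)) ^+ 2 =
      (sg * sg) * (2 * h) ^+ 2 by ring.
    by rewrite ss; nra.
  apply: (disc _ _ (r / 3) r) => //; try lra.
  by move=> x2 y2 hx hy; lra.
exists (r * (1 - q) + 2 * h), (sg * (r * q - 6 * h)); split.
  have -> : (sg * (r * q - 6 * h) - r * (sg * q)) ^+ 2 =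
    (sg * sg) * (6 * h) ^+ 2 by ring.
  by rewrite ss; nra.
apply: (disc _ _ (r / 3) r) => //; try lra.
by move=> x2 y2 hx hy; lra.
Qed.

(* The quadrant [a < 0], [e * b > 0] lies entirely on one side. *)
Lemma left_disc e a b (x y h : R) : e = 1 \/ e = -1 -> 0 < h ->
  x <= - (2 * h) -> 2 * h <= e * y ->
  (x - a) ^+ 2 + (y - b) ^+ 2 <= 1000 * h ^+ 2 ->
  exists a' b', [/\ (a' - a) ^+ 2 + (b' - b) ^+ 2 <= 1000 * h ^+ 2 &
    forall a2 b2, (a2 - a') ^+ 2 + (b2 - b') ^+ 2 < h ^+ 2 -> exists u2 th2,
    stereo a2 b2 = polar u2 th2 /\ plus_side (e * u2) (e * th2)].
Proof.
move=> he h0 hx hy hd; exists x, y; split=> // a2 b2 /(disc_box h0)[ha hb].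
have b20 : 0 < e * b2 by case: he hy => ->; lra.
have [||u2 [th2 [h1 h2 est]]] := @polar_surj_left R a2 b2 e he.
- by lra.
- exact: ltW.
by exists u2, th2; split=> //; left; have := h2 b20; lra.
Qed.

(** The quadrant [a < 0], [e * b > 0] serves every point whose norm is at most [20 * h], and at
    smaller scales the points on its boundary: those of the straight arm and those with
    [e * th = 1]. At all other points the zigzag leaves a corner to the side [e]. *)
Lemma corkscrew e a b h : e = 1 \/ e = -1 -> zigzag_curve (stereo a b) ->
  0 < h -> exists a' b', [/\ (a' - a) ^+ 2 + (b' - b) ^+ 2 <= 1000 * h ^+ 2 &
    forall a2 b2, (a2 - a') ^+ 2 + (b2 - b') ^+ 2 < h ^+ 2 -> exists u2 th2,
    stereo a2 b2 = polar u2 th2 /\ plus_side (e * u2) (e * th2)].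
Proof.
move=> he Cab h0; have ee : e * e = 1 by case: he => ->; ring.
have h2 := exprn_gt0 2 h0.
(* The constant 1000 comes from here: the centre is within [22 * h] of the point in each coordinate,
   and [22^2 + 22^2 = 968]. *)
have far : `|a| + `|b| <= 20 * h -> exists a' b',
    [/\ (a' - a) ^+ 2 + (b' - b) ^+ 2 <= 1000 * h ^+ 2 &
    forall a2 b2, (a2 - a') ^+ 2 + (b2 - b') ^+ 2 < h ^+ 2 -> exists u2 th2,
    stereo a2 b2 = polar u2 th2 /\ plus_side (e * u2) (e * th2)].
  move=> hab; apply: (@left_disc e a b (- (2 * h)) (e * (2 * h))) => //.
    by rewrite mulrA ee mul1r.
  have : - (20 * h) <= a <= 20 * h by rewrite -ler_norml; have := normr_ge0 b;
    lra.
  have : - (20 * h) <= b <= 20 * h by rewrite -ler_norml; have := normr_ge0 a;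
    lra.
  by case: he => -> hb ha; nra.
case: (zigzag_curve_stereo Cab) => [[a0 b0]|[u [th [ea eb arm]]]].
  by apply: far; rewrite a0 b0 normr0; lra.
have th2 : -2 <= th <= 2 by case: arm => [/on_arm_range|->]; lra.
have nab : `|a| + `|b| = radial u by rewrite ea eb polar_norm.
have [hr|hr] := leP (radial u) (20 * h); first by apply: far; rewrite nab.
have leftside : a <= 0 -> 0 <= e * b -> exists a' b',
    [/\ (a' - a) ^+ 2 + (b' - b) ^+ 2 <= 1000 * h ^+ 2 &
    forall a2 b2, (a2 - a') ^+ 2 + (b2 - b') ^+ 2 < h ^+ 2 -> exists u2 th2,
    stereo a2 b2 = polar u2 th2 /\ plus_side (e * u2) (e * th2)].
  move=> a0 b0; apply: (@left_disc e a b (a - 2 * h) (b + e * (2 * h))) => //.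
  - by lra.
  - by rewrite mulrDr mulrA ee mul1r; lra.
  - have -> : (b + e * (2 * h) - b) ^+ 2 = (e * e) * (2 * h) ^+ 2 by ring.
    by rewrite ee; nra.
have r0 := radial_gt0 u.
case: arm => [arm|th_2]; last first.
  apply: leftside; rewrite ?ea ?eb th_2.
    apply: mulr_ge0_le0; first exact: ltW.
    by rewrite /abscissa normr_nat subr_le0 ler1n.
  by rewrite ordinate_high ?ler1n // subrr !mulr0.
have {}arm : on_arm (e * u) (e * th).
  by case: he => ->; [rewrite !mul1r|rewrite !mulN1r; exact: on_armN].
have [eth|[sg [dir [hsg hdir hth hside]]]] := plus_side_corner arm.
  have {}eth : th = e by rewrite -[th]mul1r -ee -mulrA eth mulr1.
  apply: leftside; rewrite ?ea ?eb eth.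
    by rewrite /abscissa; case: he => ->; rewrite ?normrN normr1 subrr mulr0.
  rewrite mulrCA ordinate_mid; last by case: he => ->; rewrite ?normrN normr1.
  by rewrite ee mulr1 ltW.
have [|||||a' [b' [d' D']]] := @quadrant_disc (sg * e) (dir * e) u th h.
- by case: hsg => ->; case: he => ->; [left|right|right|left]; ring.
- by case: hdir => ->; case: he => ->; [left|right|right|left]; ring.
- by rewrite -mulrA.
- by [].
- exact: ltW.
exists a', b'; split; first by rewrite ea eb.
move=> a2 b2 /D' [u2 [th2' [est hu hth2]]]; exists u2, th2'; split=> //.
by apply: hside; rewrite -?mulrBr mulrA.
Qed.

Lemma complement_side p : (CP1 R `\` zigzag_curve) p -> exists e u th,
  [/\ e = 1 \/ e = -1, p = polar u th & plus_side (e * u) (e * th)].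
Proof.
move=> [p1 nC].
have [a [b ep]] : exists a b, p = stereo a b.
  apply: stereo_surj => // pN; apply: nC; rewrite zigzag_curveE pN.
  by left; left.
have [u [th [th2 epol]]] : exists u th, -2 < th <= 2 /\ p = polar u th.
  have [a0|a0] := leP 0 a.
    have [|u [th [_ _ h e]]] := @polar_surj_right R a b a0.
      rewrite lt_neqAle addr_ge0 // andbT; apply/eqP => /esym/eqP.
      rewrite paddr_eq0 // normr_eq0 => /andP[/eqP a_0 /eqP b_0].
      by apply: nC; rewrite zigzag_curveE ep a_0 b_0; left; right.
    by exists u, th; split; [lra|rewrite ep].
  have [b0|b0] := leP 0 b.
    have [|u [th [h _ e]]] := @polar_surj_left R a b 1 (or_introl erefl) a0.
      by rewrite mul1r.
    by exists u, th; split; [lra|rewrite ep].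
  have [|u [th [h h' e]]] := @polar_surj_left R a b (-1) (or_intror erefl) a0.
    by lra.
  exists u, th; split; last by rewrite ep.
  by have := h' ltac:(lra); lra.
have th_2 : th < 2.
  rewrite lt_neqAle; apply/andP; split; last by lra.
  apply/eqP => e; apply: nC; rewrite zigzag_curveE epol e.
  by right; right; exists u.
have [||hs|hs] := @sides_cover R u th; first by lra.
- move=> /on_armP[s [eu eth]]; apply: nC; rewrite zigzag_curveE epol eu eth.
  by right; left; exists s.
- by exists 1, u, th; split; rewrite ?mul1r //; left.
- by exists (-1), u, th; split; rewrite ?mulN1r //; right.
Qed.

Lemma width_zigzag_curve : (width zigzag_curve < +oo)%E.
Proof.
apply: (@width_corkscrew R zigzag_curve 1000 (north R) south).
- exact: zigzag_curve_CP1.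
- apply: compact_closed; first exact: norm_hausdorff.
  apply: continuous_compact; last exact: segment_compact.
  by apply: continuous_subspaceT; exact: continuous_zigzag_loop.
- by rewrite zigzag_curveE; left; left.
- by rewrite zigzag_curveE; left; right.
- exact/nesym/stereo_north.
- exact: ler0n.
move=> _ [p Cp ->] a b h Cab h0.
have [e [u [th [he ep hs]]]] := complement_side Cp.
have [a' [b' [dab disc]]] := corkscrew he Cab h0.
exists a', b'; split=> //.
  have [|u2 [th2 [-> hs2]]] := disc a' b'.
    by rewrite !subrr expr0n addr0 exprn_gt0.
  apply: (@connected_component_trans _ _ (polar (e * 0) (e * (3 / 2)))).
    by rewrite ep; exact: side_component.
  by apply: connected_component_sym; exact: side_component.
move=> a2 b2 /disc[u2 [th2 [-> hs2]]].
exact: side_zigzag_curve hs2.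
Qed.

Lemma zigzag_curve_not_quasicircle : ~ quasicircle zigzag_curve.
Proof.
have sq_ge1 (x : R) : 0 < x ^+ 2 + 1 by have := sqr_ge0 x; lra.
have chord_arm2 s : Defs.edist (north R) (arm2 s) =
    2 / Num.sqrt (radial s ^+ 2 + 1).
  rewrite /arm2 /polar edist_north ordinate_high; last by lra.
  rewrite /abscissa ger0_norm // subrr mulr0 expr0n addr0.
  by congr (2 / Num.sqrt (_ + 1)); ring.
have e_south : Defs.edist (north R) south = 2.
  by rewrite edist_north !expr0n /= !add0r sqrtr1 divr1.
apply: (@oscillating_not_quasicircle R zigzag_curve (north R)
  zigzag_loop).
- by apply: continuous_subspaceT; exact: continuous_zigzag_loop.
- exact: zigzag_loop0.
- exact: zigzag_loop1.
- exact: zigzag_loop_inj.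
- by [].
- exact: zigzag_curve_CP1.
- apply: loop_anti.
  + by rewrite chord0 chord_ge0.
  + move=> s; rewrite chord0 chord_ge0 e_south chord_arm2 /=.
    rewrite ler_pdivrMr ?sqrtr_gt0 // ler_peMr // -[leLHS]sqrtr1 ler_wsqrtr //.
    by rewrite lerDr sqr_ge0.
  + move=> s s' ss'; rewrite !chord_arm2 ler_pM2l // lef_pV2 ?posrE ?sqrtr_gt0
    //.
    rewrite ler_wsqrtr // lerD2r ler_pXn2r ?nnegrE ?(ltW (radial_gt0 _)) //.
    exact: radial_le.
move=> K d d0; have [S Sd] := line_to_unit_small d0.
(* The block is chosen far enough for its parameters to exceed [S] and for its factor of return to
   exceed [K]. *)
pose k := Num.floor (`|K| + `|S|) + 1.
have hk : `|K| + `|S| < k%:~R by exact: floorD1_gt.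
have [K0 S0] := (ler_norm K, ler_norm S); have K_0 := normr_ge0 K.
have S_0 := normr_ge0 S.
have inA : 0 <= (1 : R) <= 6 by lra.
have inB : 0 <= (3 : R) <= 6 by lra.
have [uA thA] := arm_at k inA; have [uB thB] := arm_at k inB.
have [||z1 z2] := @zig1 R 1; try lra.
have [||z3 z4] := @zig3 R 3; try lra.
(* The first turn, at [(3k + 2, 1)], and the end of the way back, at [(3k + 1, 0)], where the
   exponent of [radial] is smaller by [6k + 5]. The loop starts at infinity, so it meets [sB] before
   [sA]. *)
pose sA : R := 6 * k%:~R + 1; pose sB : R := 6 * k%:~R + 3.
exists (line_to_unit sB), (line_to_unit sA); split.
- by case/andP: (line_to_unit_itv sB).
- by apply: line_to_unit_decr; rewrite /sA /sB; lra.
- by apply: Sd; rewrite /sA; lra.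
have loopE s : zigzag_loop (line_to_unit s) = arm1 s.
  have hs := line_to_unit_itv s; rewrite /zigzag_loop loop_low; last by lra.
  by rewrite arc_in // line_to_unitK.
rewrite !loopE /arm1 /polar uA thA uB thB z1 z2 z3 z4 !edist_north.
rewrite /abscissa !ordinate_mid ?normr1 ?normr0 // subrr subr0 !mulr0 !mulr1.
rewrite expr0n /= add0r addr0.
set rA := radial _; set rB := radial _.
have rB1 : 1 <= rB by apply: le_trans (radial_ge _); lra.
have rAB : (1 + 6 * k%:~R) * rB <= rA.
  by apply: radial_ratio; rewrite !ger0_norm; nra.
have sA1 : rA <= Num.sqrt (rA ^+ 2 + 1).
  have rA0 : 0 <= rA by rewrite ltW ?radial_gt0.
  by rewrite -[leLHS](ger0_norm rA0) -sqrtr_sqr ler_wsqrtr // lerDl.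
have sB1 : Num.sqrt (rB ^+ 2 + 1) <= 2 * rB.
  have rB0 : 0 <= 2 * rB by lra.
  by rewrite -[leRHS](ger0_norm rB0) -sqrtr_sqr ler_wsqrtr //; nra.
have sA0 : 0 < Num.sqrt (rA ^+ 2 + 1) by rewrite sqrtr_gt0.
have sB0 : 0 < Num.sqrt (rB ^+ 2 + 1) by rewrite sqrtr_gt0.
have KB : K * Num.sqrt (rB ^+ 2 + 1) < Num.sqrt (rA ^+ 2 + 1).
  apply: le_lt_trans (_ : _ <= `|K| * (2 * rB)) _.
    apply: (@le_trans _ _ (`|K| * Num.sqrt (rB ^+ 2 + 1))).
      by rewrite ler_pM2r.
    exact: ler_wpM2l.
  apply: lt_le_trans (le_trans rAB sA1).
  by rewrite mulrA ltr_pM2r; lra.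
by rewrite mulrA ltr_pdivrMr // mulrAC ltr_pdivlMr //; lra.
Qed.

End Curve.

Theorem theoremA (R : realType) :
  exists C : set 'rV[R]_3,
    [/\ jordan_curve C, (width C < +oo)%E & ~ quasicircle C].
Proof.
exists (@zigzag_curve R); split.
- exact: jordan_zigzag_curve.
- exact: width_zigzag_curve.
- exact: zigzag_curve_not_quasicircle.
Qed.
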